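(* Let $f:\mathbb{D}\to\mathbb{C}$ be analytic with $\mathbb{A}_E(f(\mathbb{D}))<\infty$. For any $\theta\in\mathbb{R}$, let $L_E(\rho_0)$ denote the Euclidean length of the image under $f$ of the radial segment $[0,r_0e^{i\theta}]$, where $r_0=\tanh\frac{1}{2}\rho_0$ (so the segment has hyperbolic length $\rho_0$), i.e. $L_E(\rho_0)=\int_0^{\rho_0}\|f'(\gamma(t))\|_{H\to E}\,dt$ with $\gamma(t)=\tanh(\frac{t}{2})e^{i\theta}$. Then $$L_E(\rho_0)=o(\rho_0^{1/2})\quad\text{as }\rho_0\to\infty.$$
   Context: $\mathbb{D}=\{|z|<1\}$ carries the hyperbolic metric with density $\lambda_H(z)=2/(1-|z|^2)$; $\mathbb{C}$ carries the Euclidean metric. $\|f'(z)\|_{H\to E}=|f'(z)|/\lambda_H(z)$. $\mathbb{A}_E(f(\mathbb{D}))=\int_{\mathbb{D}}|f'(z)|^2\,dx\,dy$ is the Euclidean area of the image counting multiplicity. *)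

(* Defs.v *)
From Stdlib Require Import Reals Lra ClassicalEpsilon.
Open Scope R_scope.

Definition Cx := (R * R)%type.
Definition Cadd (z w : Cx) : Cx := (fst z + fst w, snd z + snd w).
Definition Csub (z w : Cx) : Cx := (fst z - fst w, snd z - snd w).
Definition Cmul (z w : Cx) : Cx :=
  (fst z * fst w - snd z * snd w, fst z * snd w + snd z * fst w).
Definition Cmod (z : Cx) : R := sqrt (fst z ^ 2 + snd z ^ 2).
Definition Cpolar (r theta : R) : Cx := (r * cos theta, r * sin theta).

Definition has_cderiv (f : Cx -> Cx) (z f'z : Cx) : Prop :=
  forall eps : R, 0 < eps -> exists delta : R, 0 < delta /\
    forall h : Cx, 0 < Cmod h < delta ->
      Cmod (Csub (Csub (f (Cadd z h)) (f z)) (Cmul f'z h)) <= eps * Cmod h.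

Definition analytic_on_disc (f f' : Cx -> Cx) : Prop :=
  forall z : Cx, Cmod z < 1 -> has_cderiv f z (f' z).

(* Total Riemann integral: the Riemann integral when it exists, 0 otherwise. *)
Definition RInt (g : R -> R) (a b : R) : R :=
  match excluded_middle_informative (inhabited (Riemann_integrable g a b)) with
  | left H => RiemannInt (epsilon H (fun _ => True))
  | right _ => 0
  end.

Definition lambda_H (z : Cx) : R := 2 / (1 - Cmod z ^ 2).
Definition normHE (f' : Cx -> Cx) (z : Cx) : R := Cmod (f' z) / lambda_H z.

(* Euclidean area of f(D) counting multiplicity, via polar coordinates over the
   disc of radius R0 < 1 : int_0^{2pi} int_0^{R0} |f'(r e^{it})|^2 r dr dt *)
Definition area_upto (f' : Cx -> Cx) (R0 : R) : R :=
  RInt (fun t => RInt (fun r => Cmod (f' (Cpolar r t)) ^ 2 * r) 0 R0) 0 (2 * PI).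

(* A_E(f(D)) < infinity : the (monotone) areas over discs of radius R0 < 1
   are bounded, i.e. the improper integral over D is finite. *)
Definition finite_area (f' : Cx -> Cx) : Prop :=
  exists A : R, forall R0 : R, 0 < R0 < 1 -> area_upto f' R0 <= A.

Definition gammaH (theta t : R) : Cx := Cpolar (tanh (t / 2)) theta.
Definition L_E (f' : Cx -> Cx) (theta rho0 : R) : R :=
  RInt (fun t => normHE f' (gammaH theta t)) 0 rho0.

(* Main.v *)
(* Write f(z) = sum a_n z^n.  Integrating |f'|^2 in polar coordinates gives the area
   pi sum n |a_n|^2 over the disc, so this series converges.  Since
   d/dt tanh(t/2) = (1 - tanh(t/2)^2)/2, the length is at most the integral of
   sum n |a_n| r^(n-1), that is sum_(n>=1) |a_n| r_0^n.  The terms n <= N stay bounded;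
   the others are estimated by AM-GM against the tail of sum n |a_n|^2 and against
   sum r_0^(2n)/n = -log(1 - r_0^2) <= rho_0.

   The expansion is obtained from bare complex differentiability: Goursat's bisection
   on polar rectangles shows that the integral of K(z) dz over |z| = r does not depend
   on r as long as K is holomorphic between the two circles.  For
   K(z) = (f(z) - f(z0))/(z - z0), continuous on the disc, it therefore vanishes, and
   the geometric series for 1/(z - z0) turns this into the Taylor formula. *)

Require Import Defs.
From Stdlib Require Import Reals Lra Lia ClassicalEpsilon.
From Coquelicot Require Import Coquelicot.
Open Scope R_scope.

(** * Bisection of rectangles *)

(** The integrals in the statement take the value 0 when the integrand is not Riemann integrable,
    and [f'] is given only pointwise. For the length this is harmless, as only an upper bound is
    wanted. For the area it is not: a bound on [area_upto] says nothing about [f'] until the double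
    integral is known to exist. So the power series has to come before any use of the area: its
    second-derivative majorant makes [f'] Lipschitz on smaller discs, and the inner integral becomes
    a continuous function of the angle.

    Polar coordinates serve twice. An annulus is a rectangle in (r, t) closed up by periodicity, so
    Goursat's argument needs no topology of curves, and the same coordinates make the monomials
    orthogonal for the area.

    The bound on |f'| by a series in |z| ignores the direction, whence an M that does not depend on
    [theta]. The exponent 1/2 is the Cauchy-Schwarz exponent for the pairing of the Dirichlet sum
    with the logarithmic sum; a small o, rather than a big O, comes from using only the tail of the
    Dirichlet sum. *)

Lemma nested_intervals_point (u v : nat -> R) :
  (forall n, u n <= u (S n)) -> (forall n, v (S n) <= v n) ->
  (forall n, u n <= v n) -> exists x, forall n, u n <= x <= v n.
Proof.
intros Hu Hv Huv.
assert (Hum : forall n k, u n <= u (n + k)%nat).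
{ intros n k; induction k as [|k IH]; [rewrite Nat.add_0_r; lra|].
  rewrite Nat.add_succ_r; specialize (Hu (n + k)%nat); lra. }
assert (Hvm : forall n k, v (n + k)%nat <= v n).
{ intros n k; induction k as [|k IH]; [rewrite Nat.add_0_r; lra|].
  rewrite Nat.add_succ_r; specialize (Hv (n + k)%nat); lra. }
assert (Hall : forall n m, u n <= v m).
{ intros n m; specialize (Hum n m); specialize (Hvm m n);
  rewrite (Nat.add_comm m n) in Hvm; specialize (Huv (n + m)%nat); lra. }
destruct (completeness (fun y => exists n, y = u n)) as [x [Hx1 Hx2]].
- exists (v 0%nat); intros y [n ->]; apply Hall.
- now exists (u 0%nat), 0%nat.
- exists x; intros n; split.
  + apply Hx1; now exists n.
  + apply Hx2; intros y [m ->]; apply Hall.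
Qed.

Lemma pow_half_small (A eps : R) : 0 <= A -> 0 < eps -> exists n, A * (/ 2) ^ n < eps.
Proof.
intros HA He.
destruct (pow_lt_1_zero (/ 2)) with (y := eps / (A + 1)) as [N HN].
- rewrite Rabs_pos_eq; lra.
- apply Rdiv_lt_0_compat; lra.
- exists N; specialize (HN N (le_n N)).
  rewrite Rabs_pos_eq in HN by (apply pow_le; lra).
  apply Rmult_lt_compat_r with (r := A + 1) in HN; [|lra].
  unfold Rdiv in HN; rewrite Rmult_assoc, Rinv_l, Rmult_1_r in HN by lra.
  assert (0 < (/ 2) ^ N) by (apply pow_lt; lra); nra.
Qed.

(** By contradiction: a rectangle where [P] fails has a quarter where it fails, and iterating gives
    nested failing rectangles that shrink to a point, against the local hypothesis there. *)
Lemma rectangle_bisection (P : R -> R -> R -> R -> Prop) (a b c d : R) :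
  a <= b -> c <= d ->
  (forall a b c d, a <= b -> c <= d ->
    P a ((a + b) / 2) c ((c + d) / 2) -> P ((a + b) / 2) b c ((c + d) / 2) ->
    P a ((a + b) / 2) ((c + d) / 2) d -> P ((a + b) / 2) b ((c + d) / 2) d ->
    P a b c d) ->
  (forall x y, a <= x <= b -> c <= y <= d -> exists delta, 0 < delta /\
    forall a' b' c' d', a' <= x <= b' -> c' <= y <= d' ->
      b' - a' < delta -> d' - c' < delta -> P a' b' c' d') ->
  P a b c d.
Proof.
intros Hab Hcd Hquarter Hlocal.
apply NNPP; intros HnP.
set (T := (R * R * R * R)%type).
set (bad := fun q : T => ~ P (fst (fst (fst q))) (snd (fst (fst q))) (snd (fst q)) (snd q)).
(* Takes the first failing quarter; the fourth is the default because, once the other three satisfy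
   [P], gluing forces it to fail. *)
set (step := fun q : T => let '(a, b, c, d) := q in
  let m := (a + b) / 2 in let n := (c + d) / 2 in
  if excluded_middle_informative (bad (a, m, c, n)) then (a, m, c, n) else
  if excluded_middle_informative (bad (m, b, c, n)) then (m, b, c, n) else
  if excluded_middle_informative (bad (a, m, n, d)) then (a, m, n, d) else (m, b, n, d)).
assert (Hstep : forall a b c d, a <= b -> c <= d -> bad (a, b, c, d) ->
  let '(a', b', c', d') := step (a, b, c, d) in
  bad (a', b', c', d') /\ a <= a' <= b' /\ b' <= b /\ c <= c' <= d' /\ d' <= d /\
  b' - a' = (b - a) / 2 /\ d' - c' = (d - c) / 2).
{ clear - Hquarter; intros a b c d Hab Hcd Hbad; unfold step.
  destruct (excluded_middle_informative _) as [H1|H1]; [repeat split; try assumption; lra|].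
  destruct (excluded_middle_informative _) as [H2|H2]; [repeat split; try assumption; lra|].
  destruct (excluded_middle_informative _) as [H3|H3]; [repeat split; try assumption; lra|].
  split; [|repeat split; lra].
  intros H4; apply Hbad; unfold bad in H1, H2, H3; simpl in H1, H2, H3, H4 |- *.
  apply Hquarter; try assumption; now apply NNPP. }
set (q := fun n => Nat.iter n step (a, b, c, d)).
set (qa := fun n => fst (fst (fst (q n)))); set (qb := fun n => snd (fst (fst (q n)))).
set (qc := fun n => snd (fst (q n))); set (qd := fun n => snd (q n)).
assert (Hq : forall n, q n = (qa n, qb n, qc n, qd n)).
{ intros n; unfold qa, qb, qc, qd; now destruct (q n) as [[[? ?] ?] ?]. }
assert (Hinv : forall n, bad (q n) /\ qa n <= qb n /\ qc n <= qd n /\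
  qb n - qa n = (b - a) * (/ 2) ^ n /\ qd n - qc n = (d - c) * (/ 2) ^ n /\
  qa n <= qa (S n) /\ qb (S n) <= qb n /\ qc n <= qc (S n) /\ qd (S n) <= qd n).
{ assert (Hnext : forall n, bad (q n) -> qa n <= qb n -> qc n <= qd n ->
    bad (q (S n)) /\ qa n <= qa (S n) <= qb (S n) /\ qb (S n) <= qb n /\
    qc n <= qc (S n) <= qd (S n) /\ qd (S n) <= qd n /\
    qb (S n) - qa (S n) = (qb n - qa n) / 2 /\ qd (S n) - qc (S n) = (qd n - qc n) / 2).
  { intros n H1 H2 H3; rewrite Hq in H1.
    pose proof (Hstep _ _ _ _ H2 H3 H1) as H; rewrite <- Hq in H.
    change (step (q n)) with (q (S n)) in H; rewrite Hq in H |- *; exact H. }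
  intros n; induction n as [|n (I1 & I2 & I3 & I4 & I5 & _)].
  - destruct (Hnext 0%nat) as (_ & H1 & H2 & H3 & H4 & _); try assumption.
    unfold qa, qb, qc, qd in *; simpl in *; repeat split; try assumption; lra.
  - destruct (Hnext n I1 I2 I3) as (J1 & J2 & J3 & J4 & J5 & J6 & J7).
    assert (J8 : qa (S n) <= qb (S n)) by lra.
    assert (J9 : qc (S n) <= qd (S n)) by lra.
    destruct (Hnext (S n) J1 J8 J9) as (_ & K2 & K3 & K4 & K5 & _).
    repeat split; try assumption; try lra; simpl; lra. }
destruct (nested_intervals_point qa qb) as [x Hx]; try (intros n; apply Hinv).
destruct (nested_intervals_point qc qd) as [y Hy]; try (intros n; apply Hinv).
destruct (Hlocal x y (Hx 0%nat) (Hy 0%nat)) as (delta & Hdelta & HP).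
destruct (pow_half_small ((b - a) + (d - c)) delta) as [n Hn]; try lra.
destruct (Hinv n) as (B & _ & _ & B1 & B2 & _).
assert (0 < (/ 2) ^ n) by (apply pow_lt; lra).
apply B; rewrite Hq; simpl; apply HP; auto; rewrite ?B1, ?B2; nra.
Qed.

(** * Complex derivatives *)

Notation is_Cderive := (@is_derive C_AbsRing (AbsRing_NormedModule C_AbsRing)).
Notation Ccontinuous := (@continuous C_UniformSpace C_UniformSpace).

(** [Cx] and its operations are convertible with [C] and its own, so [change] passes between them.
    The one real gap is the increment 0, excluded by [has_cderiv], where the estimate is trivial. *)
Lemma has_cderiv_is_Cderive (f : C -> C) (z l : C) : has_cderiv f z l <-> is_Cderive f z l.
Proof.
split.
- intros H; split; [apply (is_linear_scal_l (V := AbsRing_NormedModule C_AbsRing) l)|].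
  intros x Hx.
  pose proof (@is_filter_lim_locally_unique C_AbsRing (AbsRing_NormedModule C_AbsRing) z x Hx) as E.
  subst x; clear Hx.
  intros eps; destruct (H eps (cond_pos eps)) as (delta & Hdelta & Hd).
  exists (mkposreal _ Hdelta).
  change (forall w : C, Cmod (w - z) < delta ->
    Cmod ((f w - f z) - (w - z) * l) <= eps * Cmod (w - z)).
  intros w Hw.
  destruct (Req_dec (Cmod (w - z)) 0) as [E|E].
  + assert (Hwz : (w - z)%C = 0) by now apply Cmod_eq_0.
    assert (w = z) by (replace w with (w - z + z)%C by ring; rewrite Hwz; ring); subst w.
    replace (f z - f z - (z - z) * l)%C with (RtoC 0) by ring.
    rewrite E, Cmod_0; lra.
  + specialize (Hd (w - z)%C).
    replace (f w) with (f (z + (w - z))%C) by (f_equal; ring).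
    replace ((w - z) * l)%C with (l * (w - z))%C by ring.
    apply Hd; split; [|exact Hw]; generalize (Cmod_ge_0 (w - z)); 
    change Defs.Cmod with Cmod; lra.
- intros [_ H] eps Heps.
  destruct (H z (fun P HP => HP) (mkposreal _ Heps)) as [delta Hd].
  exists delta; split; [apply cond_pos|].
  change (forall h : C, 0 < Cmod h < delta ->
    Cmod ((f (z + h)%C - f z) - l * h) <= eps * Cmod h).
  intros h Hh; specialize (Hd (z + h)%C).
  change (Cmod (z + h - z) < delta ->
    Cmod ((f (z + h)%C - f z) - (z + h - z) * l) <= eps * Cmod (z + h - z)) in Hd.
  replace (z + h - z)%C with h in Hd by ring.
  rewrite (Cmult_comm l h); apply Hd, Hh.
Qed.

Lemma Ccontinuous_eps (f : C -> C) (z : C) :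
  Ccontinuous f z <-> forall eps, 0 < eps -> exists delta, 0 < delta /\
    forall w, Cmod (w - z) < delta -> Cmod (f w - f z) < eps.
Proof.
split.
- intros H eps Heps.
  assert (L : @locally C_UniformSpace (f z) (fun y => Cmod (y - f z) < eps)).
  { apply locally_C; now exists (mkposreal _ Heps). }
  apply H in L; apply locally_C in L; destruct L as [delta L].
  exists delta; split; [apply cond_pos|exact L].
- intros H P HP; apply locally_C in HP; destruct HP as [eps HP].
  destruct (H eps (cond_pos eps)) as (delta & Hdelta & Hd).
  unfold filtermap; apply locally_C; exists (mkposreal _ Hdelta); intros w Hw.
  apply HP, Hd, Hw.
Qed.

Lemma is_Cderive_continuous (f : C -> C) (z l : C) : is_Cderive f z l -> Ccontinuous f z.
Proof.
intros H; assert (H' : @ex_derive C_AbsRing (AbsRing_NormedModule C_AbsRing) f z) by (now exists l).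
apply ex_derive_continuous in H'; intros P HP.
apply locally_C; exact (H' P (proj1 (locally_C (f z) P) HP)).
Qed.

Lemma is_Cderive_mult (f g : C -> C) (z df dg : C) :
  is_Cderive f z df -> is_Cderive g z dg ->
  is_Cderive (fun w => f w * g w)%C z (df * g z + f z * dg)%C.
Proof. intros Hf Hg; exact (is_derive_mult _ _ _ _ _ Hf Hg Cmult_comm). Qed.

Lemma is_Cderive_minus_const (f : C -> C) (z df c : C) :
  is_Cderive f z df -> is_Cderive (fun w => f w - c)%C z df.
Proof.
intros Hf.
pose proof (is_derive_minus (V := AbsRing_NormedModule C_AbsRing) _ _ _ _ _ Hf
  (is_derive_const (V := AbsRing_NormedModule C_AbsRing) c z)) as H.
replace df with (minus df (zero : AbsRing_NormedModule C_AbsRing)); [exact H|].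
apply (minus_zero_r (G := AbsRing_NormedModule C_AbsRing)).
Qed.

Lemma is_Cderive_inv (z : C) : z <> 0 -> is_Cderive Cinv z (- / (z * z))%C.
Proof.
intros Hz; apply has_cderiv_is_Cderive; intros eps Heps.
assert (Hm : 0 < Cmod z) by now apply Cmod_gt_0.
set (m := Cmod z) in *.
(* The error is exactly h^2 / (z^2 (z + h)). The first bound on |h| keeps |z + h| above m / 2, so
   the error is at most 2 |h|^2 / m^3, and the second makes this at most eps |h|. *)
assert (Hd : 0 < Rmin (m / 2) (eps * (m * m * m) / 2)).
{ apply Rmin_pos; [lra|]; assert (0 < m * m * m) by (repeat apply Rmult_lt_0_compat; lra); nra. }
exists (Rmin (m / 2) (eps * (m * m * m) / 2)); split; [exact Hd|].
change (forall h : C, 0 < Cmod h < Rmin (m / 2) (eps * (m * m * m) / 2) ->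
  Cmod ((/ (z + h) - / z) - - / (z * z) * h) <= eps * Cmod h).
intros h [Hh0 Hh1].
assert (Hh2 : Cmod h < m / 2) by (eapply Rlt_le_trans; [exact Hh1|apply Rmin_l]).
assert (Hh3 : Cmod h < eps * (m * m * m) / 2) by (eapply Rlt_le_trans; [exact Hh1|apply Rmin_r]).
assert (Hzh : m / 2 < Cmod (z + h)).
{ pose proof (Cmod_triangle (z + h) (- h)) as T.
  replace (z + h + - h)%C with z in T by ring; rewrite Cmod_opp in T; fold m in T; lra. }
assert (Hzh0 : (z + h)%C <> 0) by (apply Cmod_gt_0; lra).
replace (/ (z + h) - / z - - / (z * z) * h)%C with (h * h / (z * z * (z + h)))%C
  by (field; auto).
rewrite Cmod_div by (repeat apply Cmult_neq_0; auto).
rewrite !Cmod_mult; fold m.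
assert (0 < m * m) by nra.
apply Rmult_le_reg_r with (m * m * Cmod (z + h)); [nra|].
unfold Rdiv; rewrite Rmult_assoc, Rinv_l, Rmult_1_r by nra.
rewrite (Rmult_comm eps), !Rmult_assoc; apply Rmult_le_compat_l; [lra|].
assert (m * m * (m / 2) <= m * m * Cmod (z + h)) by nra.
nra.
Qed.

Lemma is_Cderive_inv_minus (z c : C) : z <> c ->
  is_Cderive (fun w => / (w - c))%C z (- / ((z - c) * (z - c)))%C.
Proof.
intros Hz.
assert (Hz' : (z - c)%C <> 0).
{ intros E; apply Hz; replace z with (z - c + c)%C by ring; rewrite E; ring. }
pose proof (@is_derive_comp C_AbsRing (AbsRing_NormedModule C_AbsRing) Cinv (fun w => (w - c)%C)
  z _ _ (is_Cderive_inv _ Hz')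
  (is_Cderive_minus_const _ _ _ c (is_derive_id (z : C_AbsRing)))) as H.
replace (- / ((z - c) * (z - c)))%C
  with (scal (one : C_AbsRing) (- / ((z - c) * (z - c)))%C : AbsRing_NormedModule C_AbsRing).
exact H.
apply (scal_one (V := AbsRing_NormedModule C_AbsRing)).
Qed.

Lemma ex_Cderive_inv_pow (z : C) (n : nat) : z <> 0 ->
  exists l, is_Cderive (fun w => (/ w) ^ n)%C z l.
Proof.
intros Hz; induction n as [|n [l IH]].
- exists (zero : AbsRing_NormedModule C_AbsRing).
  apply (is_derive_const (V := AbsRing_NormedModule C_AbsRing) (RtoC 1)).
- eexists; simpl; apply is_Cderive_mult; [apply is_Cderive_inv, Hz|exact IH].
Qed.

(** * Integrals of complex-valued functions *)

Notation continuousRC := (@continuous R_UniformSpace C_UniformSpace).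

Lemma continuous_pair {U V W : UniformSpace} (f : U -> V) (g : U -> W) (x : U) :
  continuous f x -> continuous g x -> continuous (fun y => (f y, g y)) x.
Proof.
intros Hf Hg; apply (continuous_comp_2 f g (fun a b => (a, b)) x Hf Hg).
apply continuous_ext with (f := fun p => p); [now intros [? ?]|apply continuous_id].
Qed.

Lemma continuous_Re {U : UniformSpace} (f : U -> C) (x : U) :
  @continuous U C_UniformSpace f x -> continuous (fun y => fst (f y)) x.
Proof.
intros H; apply (continuous_comp f (fst : C_UniformSpace -> R_UniformSpace)); [exact H|].
destruct (f x); apply continuous_fst.
Qed.

Lemma continuous_Im {U : UniformSpace} (f : U -> C) (x : U) :
  @continuous U C_UniformSpace f x -> continuous (fun y => snd (f y)) x.
Proof.
intros H; apply (continuous_comp f (snd : C_UniformSpace -> R_UniformSpace)); [exact H|].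
destruct (f x); apply continuous_snd.
Qed.

Lemma continuous_Cmult {U : UniformSpace} (f g : U -> C) (x : U) :
  @continuous U C_UniformSpace f x -> @continuous U C_UniformSpace g x ->
  @continuous U C_UniformSpace (fun y => f y * g y)%C x.
Proof.
intros Hf Hg.
pose proof (continuous_Re _ _ Hf); pose proof (continuous_Im _ _ Hf).
pose proof (continuous_Re _ _ Hg); pose proof (continuous_Im _ _ Hg).
apply @continuous_pair.
- apply (continuous_minus (V := R_NormedModule)); now apply (continuous_mult (K := R_AbsRing)).
- apply (continuous_plus (V := R_NormedModule)); now apply (continuous_mult (K := R_AbsRing)).
Qed.

Lemma continuous_Cminus {U : UniformSpace} (f g : U -> C) (x : U) :
  @continuous U C_UniformSpace f x -> @continuous U C_UniformSpace g x ->
  @continuous U C_UniformSpace (fun y => f y - g y)%C x.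
Proof. exact (continuous_minus (V := C_R_NormedModule) f g x). Qed.

Definition CInt (F : R -> C) (a b : R) : C := RInt (V := C_R_CompleteNormedModule) F a b.
Notation is_CInt := (@is_RInt C_R_NormedModule).

Lemma is_CInt_continuous (F : R -> C) (a b : R) : a <= b ->
  (forall s, a <= s <= b -> continuousRC F s) -> is_CInt F a b (CInt F a b).
Proof.
intros Hab HF; apply (RInt_correct (V := C_R_CompleteNormedModule)).
apply (ex_RInt_continuous (V := C_R_CompleteNormedModule)).
rewrite Rmin_left, Rmax_right by exact Hab; exact HF.
Qed.

Lemma is_CInt_unique (F : R -> C) (a b : R) (l : C) : is_CInt F a b l -> CInt F a b = l.
Proof. exact (is_RInt_unique (V := C_R_CompleteNormedModule) F a b l). Qed.

Lemma is_CInt_ext (F G : R -> C) (a b : R) (l : C) :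
  (forall s, F s = G s) -> is_CInt F a b l -> is_CInt G a b l.
Proof. intros H; apply (is_RInt_ext (V := C_R_NormedModule)); intros s _; apply H. Qed.

Lemma is_CInt_plus (F G : R -> C) (a b : R) (l m : C) :
  is_CInt F a b l -> is_CInt G a b m -> is_CInt (fun s => F s + G s)%C a b (l + m)%C.
Proof. exact (is_RInt_plus (V := C_R_NormedModule) F G a b l m). Qed.

Lemma is_CInt_minus (F G : R -> C) (a b : R) (l m : C) :
  is_CInt F a b l -> is_CInt G a b m -> is_CInt (fun s => F s - G s)%C a b (l - m)%C.
Proof. exact (is_RInt_minus (V := C_R_NormedModule) F G a b l m). Qed.

Lemma is_CInt_const (a b : R) (c : C) : is_CInt (fun _ => c) a b (RtoC (b - a) * c)%C.
Proof.
replace (RtoC (b - a) * c)%C with (scal (b - a) (c : C_R_NormedModule) : C).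
- apply (is_RInt_const (V := C_R_NormedModule)).
- unfold scal; simpl; unfold prod_scal, scal; simpl; unfold mult; simpl.
  unfold Cmult, RtoC; simpl; f_equal; ring.
Qed.

Lemma Cmod_CInt_le (F : R -> C) (a b M : R) (l : C) : a <= b ->
  (forall s, a <= s <= b -> Cmod (F s) <= M) -> is_CInt F a b l -> Cmod l <= M * (b - a).
Proof.
intros Hab HF Hl; rewrite Cmod_norm.
replace (M * (b - a)) with (scal (b - a) M) by (unfold scal; simpl; unfold mult; simpl; ring).
apply (norm_RInt_le (V := C_R_NormedModule) F (fun _ => M) a b); auto.
- intros s Hs; rewrite <- Cmod_norm; now apply HF.
- apply (is_RInt_const (V := R_NormedModule)).
Qed.

(** The module structure behind [is_CInt] has real scalars only, so a complex factor is treated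
    component by component. *)
Lemma is_CInt_Cmult_l (F : R -> C) (a b : R) (c l : C) :
  is_CInt F a b l -> is_CInt (fun s => c * F s)%C a b (c * l)%C.
Proof.
intros H.
pose proof (is_RInt_fct_extend_fst (U := R_NormedModule) (V := R_NormedModule) _ _ _ _ H) as H1.
pose proof (is_RInt_fct_extend_snd (U := R_NormedModule) (V := R_NormedModule) _ _ _ _ H) as H2.
apply (is_RInt_fct_extend_pair (U := R_NormedModule) (V := R_NormedModule)).
- apply (is_RInt_minus (V := R_NormedModule)); now apply (is_RInt_scal (V := R_NormedModule)).
- apply (is_RInt_plus (V := R_NormedModule)); now apply (is_RInt_scal (V := R_NormedModule)).
Qed.

Lemma is_CInt_derive (F f : R -> C) (a b : R) : a <= b ->
  (forall s, a <= s <= b -> is_derive (fun s => fst (F s)) s (fst (f s))) ->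
  (forall s, a <= s <= b -> is_derive (fun s => snd (F s)) s (snd (f s))) ->
  (forall s, a <= s <= b -> continuousRC f s) -> is_CInt f a b (F b - F a)%C.
Proof.
intros Hab H1 H2 Hf.
apply (is_RInt_fct_extend_pair (U := R_NormedModule) (V := R_NormedModule)).
- apply (is_RInt_derive (V := R_CompleteNormedModule) (fun s => fst (F s)) (fun s => fst (f s)));
    rewrite Rmin_left, Rmax_right by exact Hab; auto.
  intros s Hs; apply continuous_Re; auto.
- apply (is_RInt_derive (V := R_CompleteNormedModule) (fun s => snd (F s)) (fun s => snd (f s)));
    rewrite Rmin_left, Rmax_right by exact Hab; auto.
  intros s Hs; apply continuous_Im; auto.
Qed.

(** The differentiated function is the real part of k u + c (u - w)^2 / 2 at u = x + i y.
    Multiplying k and c by -i turns it into the imaginary part, so one real computation serves for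
    both. *)
Lemma is_derive_quadratic_path (x y : R -> R) (s dx dy k1 k2 c1 c2 w1 w2 : R) :
  is_derive x s dx -> is_derive y s dy ->
  is_derive (fun s => k1 * x s - k2 * y s +
     (c1 * ((x s - w1) * (x s - w1) - (y s - w2) * (y s - w2)) -
      c2 * ((x s - w1) * (y s - w2) + (y s - w2) * (x s - w1))) * / 2) s
    ((k1 + (c1 * (x s - w1) - c2 * (y s - w2))) * dx -
     (k2 + (c1 * (y s - w2) + c2 * (x s - w1))) * dy).
Proof.
intros Hx Hy; auto_derive; [repeat split; eexists; eassumption|].
change (fun x0 : R => x x0) with x; change (fun x0 : R => y x0) with y.
rewrite (is_derive_unique x _ _ Hx), (is_derive_unique y _ _ Hy); field.
Qed.

(** An affine integrand has the primitive [F], so its integral depends on the endpoints alone and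
    will cancel around a closed boundary. What is left is the affine error, at most [eta * d],
    integrated at speed at most 1. *)
Lemma path_integral_near_affine (K : C -> C) (z z' : R -> C) (a b : R) (w k c : C) (eta d : R) :
  a <= b -> 0 <= eta ->
  (forall s, a <= s <= b -> is_derive (fun s => fst (z s)) s (fst (z' s))) ->
  (forall s, a <= s <= b -> is_derive (fun s => snd (z s)) s (snd (z' s))) ->
  (forall s, a <= s <= b -> continuousRC z' s) ->
  (forall s, a <= s <= b -> continuousRC (fun s => K (z s)) s) ->
  (forall s, a <= s <= b -> Cmod (z' s) <= 1) ->
  (forall s, a <= s <= b -> Cmod (z s - w) <= d) ->
  (forall s, a <= s <= b -> Cmod (K (z s) - (k + c * (z s - w))) <= eta * Cmod (z s - w)) ->
  let F := fun u => (k * u + c * ((u - w) * (u - w)) * RtoC (/ 2))%C in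
  Cmod (CInt (fun s => K (z s) * z' s)%C a b - (F (z b) - F (z a))) <= eta * d * (b - a).
Proof.
intros Hab Heta Hz1 Hz2 Hz' HK Hm Hd Haff F.
assert (Hz : forall s, a <= s <= b -> continuousRC z s).
{ intros s Hs; apply (continuous_ext (fun s => (fst (z s), snd (z s))));
    [now intros u; destruct (z u)|].
  apply @continuous_pair; apply (ex_derive_continuous (K := R_AbsRing) (V := R_NormedModule)); eexists; eauto. }
assert (I1 := is_CInt_continuous (fun s => K (z s) * z' s)%C a b Hab
  (fun s Hs => continuous_Cmult _ _ _ (HK s Hs) (Hz' s Hs))).
assert (I2 : is_CInt (fun s => (k + c * (z s - w)) * z' s)%C a b (F (z b) - F (z a))%C).
{ apply (is_CInt_derive (fun s => F (z s))); [exact Hab| | |].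
  - intros s Hs; specialize (Hz1 s Hs); specialize (Hz2 s Hs).
    pose proof (is_derive_quadratic_path _ _ s _ _ (fst k) (snd k) (fst c) (snd c)
      (fst w) (snd w) Hz1 Hz2) as H; simpl.
    eapply is_derive_ext; [|match type of H with is_derive _ _ ?l =>
      match goal with |- is_derive _ _ ?r => replace r with l by ring end end; exact H].
    intros t; simpl; ring.
  - intros s Hs; specialize (Hz1 s Hs); specialize (Hz2 s Hs).
    pose proof (is_derive_quadratic_path _ _ s _ _ (snd k) (- fst k) (snd c) (- fst c)
      (fst w) (snd w) Hz1 Hz2) as H; simpl.
    eapply is_derive_ext; [|match type of H with is_derive _ _ ?l =>
      match goal with |- is_derive _ _ ?r => replace r with l by ring end end; exact H].
    intros t; simpl; ring.
  - intros s Hs; apply continuous_Cmult; [|now apply Hz'].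
    apply (continuous_plus (V := C_R_NormedModule)); [apply continuous_const|].
    apply continuous_Cmult; [apply continuous_const|].
    apply continuous_Cminus; [now apply Hz|apply continuous_const]. }
apply (Cmod_CInt_le (fun s => K (z s) * z' s - (k + c * (z s - w)) * z' s)%C); [exact Hab| |].
- intros s Hs.
  replace (K (z s) * z' s - (k + c * (z s - w)) * z' s)%C
    with ((K (z s) - (k + c * (z s - w))) * z' s)%C by ring.
  rewrite Cmod_mult.
  apply Rle_trans with (eta * Cmod (z s - w) * 1).
  + apply Rmult_le_compat; auto using Cmod_ge_0.
  + rewrite Rmult_1_r; apply Rmult_le_compat_l; auto.
- exact (is_CInt_minus _ _ _ _ _ _ I1 I2).
Qed.

(** * Goursat's theorem on polar rectangles *)

Lemma Cmod_Cpolar (r t : R) : Cmod (Cpolar r t) = Rabs r.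
Proof.
unfold Cmod, Cpolar; simpl fst; simpl snd.
replace ((r * cos t) ^ 2 + (r * sin t) ^ 2) with (Rsqr r).
- apply sqrt_Rsqr_abs.
- pose proof (sin2_cos2 t) as H; unfold Rsqr in *; nra.
Qed.

Lemma Rabs_sin_le (x : R) : Rabs (sin x) <= Rabs x.
Proof.
assert (H : forall x, 0 < x -> Rabs (sin x) <= x).
{ intros u Hu; apply Rabs_le; split; [|apply Rlt_le, sin_lt_x, Hu].
  destruct (Rle_lt_dec u 1).
  - apply Rle_trans with 0; [lra|]; apply sin_ge_0; [lra|]; pose proof PI2_1; lra.
  - pose proof (SIN_bound u); lra. }
destruct (Rtotal_order x 0) as [Hx|[->|Hx]].
- rewrite (Rabs_left x) by exact Hx; rewrite <- Rabs_Ropp, <- sin_neg; apply H; lra.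
- rewrite sin_0; lra.
- rewrite (Rabs_pos_eq x) by lra; now apply H.
Qed.

Lemma Cpolar_Lipschitz (r s t u : R) : Rabs s <= 1 ->
  Cmod (Cpolar r t - Cpolar s u) <= Rabs (r - s) + Rabs (t - u).
Proof.
intros Hs.
replace (Cpolar r t - Cpolar s u)%C
  with (Cpolar (r - s) t + RtoC s * (Cpolar 1 t - Cpolar 1 u))%C
  by (unfold Cpolar, Cminus, Cplus, Copp, Cmult, RtoC; simpl; f_equal; ring).
eapply Rle_trans; [apply Cmod_triangle|].
apply Rplus_le_compat; [rewrite Cmod_Cpolar; lra|].
rewrite Cmod_mult, Cmod_R.
assert (H : Cmod (Cpolar 1 t - Cpolar 1 u) <= Rabs (t - u)).
{ unfold Cmod; rewrite <- sqrt_Rsqr_abs; apply sqrt_le_1_alt; simpl fst; simpl snd.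
  pose proof (Rabs_sin_le ((t - u) / 2)) as H; apply Rsqr_le_abs_1 in H.
  (* The squared chord is 2 - 2 cos(t - u) = 4 sin^2((t - u) / 2), hence at most (t - u)^2. *)
  assert (H1 : cos (t - u) = 1 - 2 * sin ((t - u) / 2) * sin ((t - u) / 2)).
  { rewrite <- cos_2a_sin; f_equal; field. }
  rewrite cos_minus in H1; unfold Rsqr in *.
  pose proof (sin2_cos2 t) as H2; pose proof (sin2_cos2 u) as H3; unfold Rsqr in *; nra. }
pose proof (Cmod_ge_0 (Cpolar 1 t - Cpolar 1 u)); pose proof (Rabs_pos s); nra.
Qed.

Lemma continuous_Cpolar_radius (t r : R) : continuousRC (fun s => Cpolar s t) r.
Proof.
apply @continuous_pair; apply (ex_derive_continuous (K := R_AbsRing) (V := R_NormedModule));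
  auto_derive; trivial.
Qed.

Lemma continuous_Cpolar_angle (r t : R) : continuousRC (fun s => Cpolar r s) t.
Proof.
apply @continuous_pair; apply (ex_derive_continuous (K := R_AbsRing) (V := R_NormedModule));
  auto_derive; trivial.
Qed.

Lemma CInt_Chasles (F : R -> C) (a m b : R) : a <= m <= b ->
  (forall s, a <= s <= b -> continuousRC F s) -> CInt F a b = (CInt F a m + CInt F m b)%C.
Proof.
intros Hm HF; apply is_CInt_unique.
apply (is_RInt_Chasles (V := C_R_NormedModule) F a m b);
  apply is_CInt_continuous; try lra; intros s Hs; apply HF; lra.
Qed.

Definition radial_int (K : C -> C) (t a b : R) : C :=
  CInt (fun s => K (Cpolar s t) * Cpolar 1 t)%C a b.
Definition angular_int (K : C -> C) (r a b : R) : C :=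
  CInt (fun s => K (Cpolar r s) * (Ci * Cpolar r s))%C a b.
Definition boundary_int (K : C -> C) (a b c d : R) : C :=
  (radial_int K c a b + angular_int K b c d - radial_int K d a b - angular_int K a c d)%C.

Definition circle_int (K : C -> C) (r : R) : C := angular_int K r 0 (2 * PI).

Section Goursat.

Variables (K : C -> C) (rho1 rho2 : R).
Hypothesis Hrho1 : 0 <= rho1.
Hypothesis Hrho2 : rho2 <= 1.
Hypothesis HK : forall z, rho1 < Cmod z < rho2 -> exists l, is_Cderive K z l.

Lemma continuous_on_radius (t r : R) : rho1 < r < rho2 ->
  continuousRC (fun s => K (Cpolar s t)) r.
Proof.
intros Hr; apply (continuous_comp (fun s => Cpolar s t) K); [apply continuous_Cpolar_radius|].
destruct (HK (Cpolar r t)) as [l Hl].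
- rewrite Cmod_Cpolar, Rabs_pos_eq; lra.
- eapply is_Cderive_continuous; exact Hl.
Qed.

Lemma continuous_on_angle (r t : R) : rho1 < r < rho2 ->
  continuousRC (fun s => K (Cpolar r s)) t.
Proof.
intros Hr; apply (continuous_comp (fun s => Cpolar r s) K); [apply continuous_Cpolar_angle|].
destruct (HK (Cpolar r t)) as [l Hl].
- rewrite Cmod_Cpolar, Rabs_pos_eq; lra.
- eapply is_Cderive_continuous; exact Hl.
Qed.

Lemma radial_int_Chasles (t a m b : R) : rho1 < a -> a <= m <= b -> b < rho2 ->
  radial_int K t a b = (radial_int K t a m + radial_int K t m b)%C.
Proof.
intros Ha Hm Hb; apply CInt_Chasles; [exact Hm|]; intros s Hs.
apply continuous_Cmult; [apply continuous_on_radius; lra|apply continuous_const].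
Qed.

Lemma continuous_angular_tangent (r s : R) : continuousRC (fun s => Ci * Cpolar r s)%C s.
Proof. apply continuous_Cmult; [apply continuous_const|apply continuous_Cpolar_angle]. Qed.

Lemma angular_int_Chasles (r a m b : R) : rho1 < r < rho2 -> a <= m <= b ->
  angular_int K r a b = (angular_int K r a m + angular_int K r m b)%C.
Proof.
intros Hr Hm; apply CInt_Chasles; [exact Hm|]; intros s Hs.
apply continuous_Cmult; [now apply continuous_on_angle|apply continuous_angular_tangent].
Qed.

Lemma boundary_int_quarters (a b c d : R) : rho1 < a -> a <= b -> b < rho2 -> c <= d ->
  let m := (a + b) / 2 in let n := (c + d) / 2 in
  boundary_int K a b c d =
    (boundary_int K a m c n + boundary_int K m b c n +
     (boundary_int K a m n d + boundary_int K m b n d))%C.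
Proof.
intros Ha Hab Hb Hcd m n; unfold boundary_int.
assert (a <= m <= b) by (unfold m; lra); assert (c <= n <= d) by (unfold n; lra).
rewrite (radial_int_Chasles c a m b), (radial_int_Chasles d a m b) by lra.
rewrite (angular_int_Chasles a c n d), (angular_int_Chasles b c n d) by lra.
ring.
Qed.

(** Differentiability at the single point [w] makes [K] affine up to a small multiple of the
    distance to [w]. Inside the unit disc, radial and angular paths both have speed at most 1, and
    distances to [w] are bounded by the sum of the parameter sides. *)
Lemma boundary_int_local (eps x y : R) : 0 < eps -> rho1 < x < rho2 ->
  exists delta, 0 < delta /\ forall a b c d, a <= x <= b -> c <= y <= d ->
    b - a < delta -> d - c < delta -> rho1 < a -> b < rho2 ->
    Cmod (boundary_int K a b c d) <= eps * ((b - a) ^ 2 + (d - c) ^ 2).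
Proof.
intros Heps Hx; set (w := Cpolar x y : C).
destruct (HK w) as [l Hl]; [unfold w; rewrite Cmod_Cpolar, Rabs_pos_eq; lra|].
apply has_cderiv_is_Cderive in Hl.
destruct (Hl (eps / 4)) as (delta & Hdelta & Hd); [lra|].
exists (delta / 2); split; [lra|]; intros a b c d Hax Hcy Hab Hcd Ha Hb.
assert (Haff : forall z : C, Cmod (z - w) < delta ->
  Cmod (K z - (K w + l * (z - w))) <= eps / 4 * Cmod (z - w)).
{ intros z Hz; destruct (Req_dec (Cmod (z - w)) 0) as [E|E].
  - apply Cmod_eq_0 in E; assert (z = w) by (replace z with (z - w + w)%C by ring; rewrite E; ring).
    subst z; replace (K w - (K w + l * (w - w)))%C with (RtoC 0) by ring.
    rewrite Cmod_0; pose proof (Cmod_ge_0 (w - w)); nra.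
  - assert (H : 0 < Cmod (z - w) < delta) by (generalize (Cmod_ge_0 (z - w)); lra).
    apply Hd in H.
    change (Cmod ((K (w + (z - w))%C - K w) - l * (z - w)) <= eps / 4 * Cmod (z - w)) in H.
    replace (w + (z - w))%C with z in H by ring.
    replace (K z - (K w + l * (z - w)))%C with ((K z - K w) - l * (z - w))%C by ring.
    exact H. }
set (e := (b - a) + (d - c)).
assert (Hnear : forall s t, a <= s <= b -> c <= t <= d -> Cmod (Cpolar s t - w) <= e).
{ intros s t Hs Ht; unfold w; eapply Rle_trans; [apply Cpolar_Lipschitz|].
  - rewrite Rabs_pos_eq; lra.
  - unfold e; apply Rplus_le_compat; apply Rabs_le; lra. }
assert (He : e < delta) by (unfold e; lra).
set (F := fun u => (K w * u + l * ((u - w) * (u - w)) * RtoC (/ 2))%C).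
assert (Hrad : forall t, c <= t <= d ->
  Cmod (radial_int K t a b - (F (Cpolar b t) - F (Cpolar a t))) <= eps / 4 * e * (b - a)).
{ intros t Ht; apply (path_integral_near_affine K (fun s => Cpolar s t) (fun _ => Cpolar 1 t));
    try lra; intros s Hs.
  - simpl; auto_derive; [trivial|ring].
  - simpl; auto_derive; [trivial|ring].
  - apply continuous_const.
  - apply continuous_on_radius; lra.
  - rewrite Cmod_Cpolar, Rabs_pos_eq; lra.
  - now apply Hnear.
  - apply Haff; eapply Rle_lt_trans; [now apply Hnear|exact He]. }
assert (Hang : forall r, a <= r <= b ->
  Cmod (angular_int K r c d - (F (Cpolar r d) - F (Cpolar r c))) <= eps / 4 * e * (d - c)).
{ intros r Hr; apply (path_integral_near_affine K (fun s => Cpolar r s) (fun s => Ci * Cpolar r s)%C);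
    try lra; intros s Hs.
  - simpl; auto_derive; [trivial|ring].
  - simpl; auto_derive; [trivial|ring].
  - apply continuous_angular_tangent.
  - apply continuous_on_angle; lra.
  - rewrite Cmod_mult, Cmod_Ci, Cmod_Cpolar, Rabs_pos_eq; lra.
  - now apply Hnear.
  - apply Haff; eapply Rle_lt_trans; [now apply Hnear|exact He]. }
assert (Hc : c <= c <= d) by lra; assert (Hdd : c <= d <= d) by lra.
assert (Haa : a <= a <= b) by lra; assert (Hbb : a <= b <= b) by lra.
apply Hrad in Hc, Hdd; apply Hang in Haa, Hbb.
unfold boundary_int.
match type of Hc with Cmod ?u <= _ => set (u1 := u) in * end.
match type of Hdd with Cmod ?u <= _ => set (u2 := u) in * end.
match type of Haa with Cmod ?u <= _ => set (u3 := u) in * end.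
match type of Hbb with Cmod ?u <= _ => set (u4 := u) in * end.
(* Each corner value of [F] occurs twice with opposite signs and drops out; only the four side
   errors remain. *)
match goal with |- Cmod ?u <= _ => replace u with ((u1 + u4) + - (u2 + u3))%C
  by (unfold u1, u2, u3, u4; ring) end.
pose proof (Cmod_triangle (u1 + u4) (- (u2 + u3))) as T1; rewrite Cmod_opp in T1.
pose proof (Cmod_triangle u1 u4) as T2; pose proof (Cmod_triangle u2 u3) as T3.
(* The four sides have total parameter length 2 e, and e^2 is at most twice the sum of the squared
   sides. *)
apply Rle_trans with (eps / 4 * e * (2 * e)).
- unfold e in *; lra.
- unfold e; assert (0 <= eps * ((b - a) - (d - c)) ^ 2) by (apply Rmult_le_pos; [lra|apply pow2_ge_0]); lra.
Qed.

(* Bisecting a rectangle quarters [(b - a)^2 + (d - c)^2], so the local bound is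
   stable under gluing whatever the shape of the rectangle. *)
Lemma boundary_int_eq0 (a b c d : R) : rho1 < a -> a <= b -> b < rho2 -> c <= d ->
  boundary_int K a b c d = 0.
Proof.
intros Ha Hab Hb Hcd; apply Cmod_eq_0, Rle_antisym; [|apply Cmod_ge_0].
apply Rle_plus_epsilon; intros eps Heps.
set (sz := (b - a) ^ 2 + (d - c) ^ 2).
assert (Hsz : 0 <= sz) by (unfold sz; nra).
assert (Heps' : 0 < eps / (sz + 1)) by (apply Rdiv_lt_0_compat; lra).
assert (H : rho1 < a -> b < rho2 -> Cmod (boundary_int K a b c d) <= eps / (sz + 1) * sz).
{ unfold sz at 2; revert Heps'; generalize (eps / (sz + 1)); intros eta Heta.
  (* The bisection principle ranges over all rectangles, so lying in the annulus is made a premise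
     of the property. *)
  apply (rectangle_bisection (fun a b c d => rho1 < a -> b < rho2 ->
    Cmod (boundary_int K a b c d) <= eta * ((b - a) ^ 2 + (d - c) ^ 2))); auto.
  - clear a b c d Ha Hab Hb Hcd sz Hsz.
    intros a b c d Hab Hcd H1 H2 H3 H4 Ha Hb.
    rewrite boundary_int_quarters by assumption.
    eapply Rle_trans; [apply Cmod_triangle|].
    eapply Rle_trans; [apply Rplus_le_compat; apply Cmod_triangle|].
    eapply Rle_trans; [apply Rplus_le_compat; apply Rplus_le_compat;
      [apply H1|apply H2|apply H3|apply H4]; lra|].
    apply Req_le; field.
  - intros x y Hx Hy; apply boundary_int_local; lra. }
eapply Rle_trans; [now apply H|]; rewrite Rplus_0_l.
unfold Rdiv; rewrite Rmult_assoc; rewrite <- (Rmult_1_r eps) at 2.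
apply Rmult_le_compat_l; [lra|].
apply Rmult_le_reg_l with (sz + 1); [lra|].
rewrite <- Rmult_assoc, Rinv_r by lra; lra.
Qed.

(** The closed annulus is the polar rectangle with angles 0 to 2 pi. Its two radial sides are the
    same segment run in opposite directions, so only the circles contribute. *)
Lemma circle_int_const (r r' : R) : rho1 < r -> r <= r' -> r' < rho2 ->
  circle_int K r' = circle_int K r.
Proof.
intros Hr Hrr Hr'.
pose proof PI_RGT_0 as HPI.
assert (H := boundary_int_eq0 r r' 0 (2 * PI) Hr Hrr Hr' ltac:(lra)).
assert (Hperiod : radial_int K (2 * PI) r r' = radial_int K 0 r r').
{ unfold radial_int, CInt; apply (RInt_ext (V := C_R_CompleteNormedModule)); intros s _.
  unfold Cpolar; now rewrite cos_2PI, sin_2PI, cos_0, sin_0. }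
unfold boundary_int in H; rewrite Hperiod in H; unfold circle_int.
rewrite <- (Cplus_0_l (angular_int K r 0 (2 * PI))), <- H; ring.
Qed.

End Goursat.

(** * Circle integrals of functions with one exceptional point *)

Lemma Cmod_le_Rabs (z : C) : Cmod z <= Rabs (fst z) + Rabs (snd z).
Proof.
pose proof (Rabs_pos (fst z)); pose proof (Rabs_pos (snd z)).
unfold Cmod; rewrite <- (sqrt_Rsqr (Rabs (fst z) + Rabs (snd z))) by lra.
apply sqrt_le_1_alt; unfold Rsqr; rewrite <- (pow2_abs (fst z)), <- (pow2_abs (snd z)); nra.
Qed.

Lemma continuous_Cpolar (r t : R) :
  @continuous (prod_UniformSpace R_UniformSpace R_UniformSpace) C_UniformSpace
    (fun p => Cpolar (fst p) (snd p)) (r, t).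
Proof.
apply @continuous_pair; apply (continuous_mult (K := R_AbsRing)); try apply continuous_fst;
  apply (continuous_comp snd); try apply continuous_snd;
  apply (ex_derive_continuous (K := R_AbsRing) (V := R_NormedModule)); simpl; auto_derive; trivial.
Qed.

(** Mere continuity of [K] suffices here, which makes it possible to pass across a circle that
    contains a point where differentiability is unknown. *)
Lemma circle_int_continuous (K : C -> C) (r : R) :
  (forall z, Cmod z < 1 -> Ccontinuous K z) -> 0 <= r < 1 ->
  forall eps, 0 < eps -> exists delta, 0 < delta /\ forall r', 0 <= r' < 1 ->
    Rabs (r' - r) < delta -> Cmod (circle_int K r' - circle_int K r) <= eps.
Proof.
intros HK Hr eps Heps.
pose proof PI_RGT_0 as HPI.
set (G := fun p : R * R => (K (Cpolar (fst p) (snd p)) * (Ci * Cpolar (fst p) (snd p)))%C).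
assert (HG : forall s t, 0 <= s < 1 ->
  @continuous (prod_UniformSpace R_UniformSpace R_UniformSpace) C_UniformSpace G (s, t)).
{ intros s t Hs; apply continuous_Cmult.
  - apply (continuous_comp (fun p => Cpolar (fst p) (snd p)) K); [apply continuous_Cpolar|].
    apply HK; change (Cmod (Cpolar s t) < 1); rewrite Cmod_Cpolar, Rabs_pos_eq; lra.
  - apply continuous_Cmult; [apply continuous_const|apply continuous_Cpolar]. }
(* Real and imaginary parts each vary by at most [eta], over an interval of length 2 pi. *)
assert (Heta : 0 < eps / (4 * PI)) by (apply Rdiv_lt_0_compat; lra).
set (eta := mkposreal _ Heta).
destruct (uniform_continuity_2d_1d' (fun s t => fst (G (s, t))) 0 (2 * PI) r) with (eps := eta)
  as [d1 H1].
{ intros t Ht; apply (proj2 (continuity_2d_pt_filterlim _ _ _)).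
  assert (HGt := continuous_Re G (r, t) (HG r t Hr)).
  apply (filterlim_ext (fun p => fst (G p))); [now intros [? ?]|exact HGt]. }
destruct (uniform_continuity_2d_1d' (fun s t => snd (G (s, t))) 0 (2 * PI) r) with (eps := eta)
  as [d2 H2].
{ intros t Ht; apply (proj2 (continuity_2d_pt_filterlim _ _ _)).
  assert (HGt := continuous_Im G (r, t) (HG r t Hr)).
  apply (filterlim_ext (fun p => snd (G p))); [now intros [? ?]|exact HGt]. }
exists (Rmin d1 d2); split; [apply Rmin_pos; apply cond_pos|].
intros r' Hr' Hd.
assert (Hd1 : Rabs (r' - r) < d1) by (eapply Rlt_le_trans; [exact Hd|apply Rmin_l]).
assert (Hd2 : Rabs (r' - r) < d2) by (eapply Rlt_le_trans; [exact Hd|apply Rmin_r]).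
apply Rabs_def2 in Hd1, Hd2.
assert (HI : forall s, 0 <= s < 1 -> is_CInt (fun t => G (s, t)) 0 (2 * PI) (circle_int K s)).
{ intros s Hs; apply is_CInt_continuous; [lra|]; intros t _.
  apply (continuous_comp (fun t => (s, t)) G).
  - apply @continuous_pair; [apply continuous_const|apply continuous_id].
  - now apply HG. }
replace eps with (eps / (2 * PI) * (2 * PI - 0)) by (field; lra).
apply (Cmod_CInt_le (fun t => G (r', t) - G (r, t))%C); [lra| |].
- intros t Ht.
  pose proof (cond_pos d1); pose proof (cond_pos d2).
  specialize (H1 t r t r'); specialize (H2 t r t r').
  cbn beta in H1, H2.
  assert (Z : Rabs (t - t) = 0) by (rewrite Rminus_diag; apply Rabs_R0).
  eapply Rle_trans; [apply Cmod_le_Rabs|].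
  replace (eps / (2 * PI)) with (eta + eta) by (simpl; field; lra).
  apply Rplus_le_compat; apply Rlt_le; [apply H1|apply H2]; lra.
- exact (is_CInt_minus _ _ _ _ _ _ (HI r' Hr') (HI r Hr)).
Qed.

(** Differentiability is assumed strictly between the circles only; the bounding circles are reached
    as limits of inner ones. *)
Lemma circle_int_const_closed (K : C -> C) (p q : R) :
  (forall z, Cmod z < 1 -> Ccontinuous K z) -> 0 <= p < q -> q < 1 ->
  (forall z, p < Cmod z < q -> exists l, is_Cderive K z l) ->
  circle_int K q = circle_int K p.
Proof.
intros Hcont Hpq Hq HK.
assert (H0 : (circle_int K q - circle_int K p)%C = 0).
{ apply Cmod_eq_0, Rle_antisym; [|apply Cmod_ge_0].
  apply Rle_plus_epsilon; intros eps Heps.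
  destruct (circle_int_continuous K p Hcont ltac:(lra) (eps / 2)) as (d1 & Hd1 & H1); [lra|].
  destruct (circle_int_continuous K q Hcont ltac:(lra) (eps / 2)) as (d2 & Hd2 & H2); [lra|].
  (* Capping at the midpoint keeps both radii strictly inside and in the order u <= v. *)
  set (u := Rmin (p + d1 / 2) ((p + q) / 2)); set (v := Rmax (q - d2 / 2) ((p + q) / 2)).
  assert (Hu : p < u <= (p + q) / 2) by (unfold u; split; [apply Rmin_glb_lt; lra|apply Rmin_r]).
  assert (Hu' : u <= p + d1 / 2) by apply Rmin_l.
  assert (Hv : (p + q) / 2 <= v < q) by (unfold v; split; [apply Rmax_r|apply Rmax_lub_lt; lra]).
  assert (Hv' : q - d2 / 2 <= v) by apply Rmax_l.
  assert (E : circle_int K v = circle_int K u).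
  { apply (circle_int_const K p q); try lra; exact HK. }
  specialize (H1 u ltac:(lra) ltac:(apply Rabs_def1; lra)).
  specialize (H2 v ltac:(lra) ltac:(apply Rabs_def1; lra)).
  replace (circle_int K q - circle_int K p)%C
    with ((circle_int K u - circle_int K p) + - (circle_int K v - circle_int K q))%C
    by (rewrite E; ring).
  eapply Rle_trans; [apply Cmod_triangle|rewrite Cmod_opp; lra]. }
replace (circle_int K q) with (circle_int K q - circle_int K p + circle_int K p)%C by ring.
rewrite H0; ring.
Qed.

Lemma circle_int_0 (K : C -> C) : circle_int K 0 = 0.
Proof.
apply is_CInt_unique; rewrite <- (Cmult_0_r (RtoC (2 * PI - 0))).
refine (is_CInt_ext _ _ _ _ _ _ (is_CInt_const _ _ _)); intros t.
unfold Cpolar, Ci, Cmult, RtoC; simpl; f_equal; ring.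
Qed.

(** Only the circle of radius |z0| meets the exceptional point. The integral is therefore constant
    on each side of that radius, up to and including it, and it is 0 at radius 0, where the tangent
    vector vanishes. *)
Lemma circle_int_punctured (K : C -> C) (z0 : C) (r : R) :
  (forall z, Cmod z < 1 -> Ccontinuous K z) ->
  (forall z, Cmod z < 1 -> z <> z0 -> exists l, is_Cderive K z l) ->
  Cmod z0 < r < 1 -> circle_int K r = 0.
Proof.
intros Hcont HK Hr.
pose proof (Cmod_ge_0 z0) as H0.
rewrite <- (circle_int_0 K).
transitivity (circle_int K (Cmod z0)).
- apply circle_int_const_closed; try assumption; try lra.
  intros z Hz; apply HK; [lra|]; intros ->; lra.
- destruct (Req_dec (Cmod z0) 0) as [->|E]; [reflexivity|].
  apply circle_int_const_closed; try assumption; try lra.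
  intros z Hz; apply HK; [lra|]; intros ->; lra.
Qed.

(** * Taylor expansion *)

Lemma Cpolar_pow (r t : R) (n : nat) : (Cpolar r t ^ n)%C = Cpolar (r ^ n) (INR n * t).
Proof.
induction n as [|n IH].
- unfold Cpolar; simpl; rewrite Rmult_0_l, cos_0, sin_0; unfold RtoC; f_equal; ring.
- rewrite Cpow_S, IH, S_INR, Rmult_plus_distr_r, Rmult_1_l.
  unfold Cpolar, Cmult; simpl; rewrite cos_plus, sin_plus; f_equal; ring.
Qed.

Lemma Cpolar_neq_0 (r t : R) : 0 < r -> Cpolar r t <> RtoC 0.
Proof. intros Hr; apply Cmod_gt_0; change Cx with C; rewrite Cmod_Cpolar, Rabs_pos_eq; lra. Qed.

Lemma Cpolar_inv (r t : R) : 0 < r -> (/ Cpolar r t)%C = Cpolar (/ r) (- t).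
Proof.
intros Hr; pose proof (Cpolar_neq_0 r t Hr) as Hz.
assert (H : (Cpolar r t * Cpolar (/ r) (- t))%C = 1).
{ unfold Cpolar, Cmult; simpl; rewrite cos_neg, sin_neg; unfold RtoC; f_equal; [|field; lra].
  transitivity (Rsqr (sin t) + Rsqr (cos t)); [unfold Rsqr; field; lra|apply sin2_cos2]. }
rewrite <- (Cmult_1_r (/ Cpolar r t)), <- H; field; exact Hz.
Qed.

(** The relational form carries integrability along with the value, so linear combinations need no
    separate existence proofs. *)
Definition is_circle_int (K : C -> C) (r : R) (l : C) : Prop :=
  is_CInt (fun t => K (Cpolar r t) * (Ci * Cpolar r t))%C 0 (2 * PI) l.

Definition two_pi_i : C := (RtoC (2 * PI) * Ci)%C.

Lemma two_pi_i_neq_0 : two_pi_i <> 0.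
Proof.
apply Cmult_neq_0; [|intros H; injection H; lra].
intros H; apply RtoC_inj in H; pose proof PI_RGT_0; lra.
Qed.

Lemma is_circle_int_inv (r : R) : 0 < r -> is_circle_int (fun z => / z)%C r two_pi_i.
Proof.
intros Hr; unfold is_circle_int.
apply (is_CInt_ext (fun _ => Ci)).
- intros t; pose proof (Cpolar_neq_0 r t Hr); symmetry; field; assumption.
- replace two_pi_i with (RtoC (2 * PI - 0) * Ci)%C; [apply is_CInt_const|].
  unfold two_pi_i; do 2 f_equal; ring.
Qed.

(** With exponent at least 2 the integrand has the single-valued primitive -z^-(n+1) / (n+1), which
    returns to its initial value after a full turn. *)
Lemma is_circle_int_inv_pow (r : R) (n : nat) : 0 < r ->
  is_circle_int (fun z => (/ z) ^ (S (S n)))%C r 0.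
Proof.
intros Hr; set (m := INR (S n)); assert (Hm : 0 < m) by (apply lt_0_INR; lia).
set (F := fun t => (RtoC (- / m) * Cpolar ((/ r) ^ S n) (- (m * t)))%C).
assert (HF : (F (2 * PI)%R - F 0%R)%C = 0).
{ unfold F; replace (- (m * 0)) with 0 by ring.
  replace (Cpolar ((/ r) ^ S n) (- (m * (2 * PI)))) with (Cpolar ((/ r) ^ S n) 0); [ring|].
  unfold Cpolar; rewrite cos_neg, sin_neg.
  replace (m * (2 * PI)) with (0 + 2 * INR (S n) * PI) by (unfold m; ring).
  rewrite cos_period, sin_period, cos_0, sin_0; f_equal; ring. }
unfold is_circle_int; rewrite <- HF.
apply (is_CInt_ext
  (fun t => Ci * Cpolar ((/ r) ^ S n) (- (m * t)))%C).
- intros t; pose proof (Cpolar_neq_0 r t Hr).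
  replace (- (m * t)) with (INR (S n) * - t) by (unfold m; ring).
  rewrite <- Cpolar_pow, <- Cpolar_inv by exact Hr.
  rewrite (Cpow_S _ (S n)); field; assumption.
- pose proof PI_RGT_0.
  apply is_CInt_derive; [lra| | |].
  + intros t _; unfold F; simpl; auto_derive; [trivial|field; lra].
  + intros t _; unfold F; simpl; auto_derive; [trivial|field; lra].
  + intros t _; apply continuous_Cmult; [apply continuous_const|].
    apply @continuous_pair; apply (ex_derive_continuous (K := R_AbsRing) (V := R_NormedModule));
      auto_derive; trivial.
Qed.

(** The index [n] itself is excluded, unlike in [sum_n]. *)
Fixpoint Csum (u : nat -> C) (n : nat) : C :=
  match n with O => 0 | S n => (Csum u n + u n)%C end.

Section Taylor.

Variables f f' : C -> C.
Hypothesis Hf : analytic_on_disc f f'.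

(** Cauchy's coefficient formula. The radius 1/2 is arbitrary: the integrand is holomorphic on 0 <
    |z| < 1, so every circle there gives the same value. *)
Definition taylor_coef (n : nat) : C :=
  (circle_int (fun z => f z * (/ z) ^ S n) (/ 2) / two_pi_i)%C.

Lemma analytic_is_Cderive (z : C) : Cmod z < 1 -> is_Cderive f z (f' z).
Proof. intros Hz; apply has_cderiv_is_Cderive, Hf, Hz. Qed.

Lemma is_circle_int_taylor (n : nat) (r : R) : 0 < r < 1 ->
  is_circle_int (fun z => f z * (/ z) ^ S n)%C r (two_pi_i * taylor_coef n).
Proof.
intros Hr.
assert (HK : forall z, 0 < Cmod z < 1 ->
  exists l, is_Cderive (fun z => f z * (/ z) ^ S n)%C z l).
{ intros z Hz; destruct (ex_Cderive_inv_pow z (S n)) as [l Hl]; [apply Cmod_gt_0; lra|].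
  eexists; apply is_Cderive_mult; [apply analytic_is_Cderive; lra|exact Hl]. }
replace (two_pi_i * taylor_coef n)%C with (circle_int (fun z => f z * (/ z) ^ S n)%C r).
- pose proof PI_RGT_0; apply is_CInt_continuous; [lra|]; intros t _.
  apply continuous_Cmult; [|apply continuous_angular_tangent].
  apply (continuous_on_angle (fun z => f z * (/ z) ^ S n)%C 0 1); auto; lra.
- transitivity (circle_int (fun z => f z * (/ z) ^ S n)%C (/ 2)).
  + destruct (Rle_dec r (/ 2)); [symmetry|];
      apply (circle_int_const _ 0 1); auto; lra.
  + unfold taylor_coef; field; apply two_pi_i_neq_0.
Qed.

Lemma bounded_on_circle (K : C -> C) (r : R) : 0 <= r < 1 ->
  (forall z, Cmod z < 1 -> Ccontinuous K z) ->
  exists M, 0 <= M /\ forall t, 0 <= t <= 2 * PI -> Cmod (K (Cpolar r t)) <= M.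
Proof.
intros Hr HK; pose proof PI_RGT_0.
destruct (continuity_ab_maj (fun t => Cmod (K (Cpolar r t))) 0 (2 * PI)) as [m [Hm _]]; [lra| |].
- intros t _; apply continuity_pt_filterlim.
  apply (continuous_ext (fun t => norm (K (Cpolar r t) : C_R_NormedModule))).
  + intros x; symmetry; apply Cmod_norm.
  + apply (continuous_comp (fun t => K (Cpolar r t)) (norm (V := C_R_NormedModule))).
    * apply (continuous_comp (fun t => Cpolar r t) K); [apply continuous_Cpolar_angle|].
      apply HK; rewrite Cmod_Cpolar, Rabs_pos_eq; lra.
    * apply (filterlim_norm (V := C_R_NormedModule)).
- exists (Cmod (K (Cpolar r m))); split; [apply Cmod_ge_0|exact Hm].
Qed.

Lemma analytic_continuous (z : C) : Cmod z < 1 -> Ccontinuous f z.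
Proof. intros Hz; eapply is_Cderive_continuous, analytic_is_Cderive, Hz. Qed.

Lemma Cmod_circle_int_le (K : C -> C) (r M : R) (l : C) : 0 <= r ->
  (forall t, 0 <= t <= 2 * PI -> Cmod (K (Cpolar r t)) <= M) ->
  is_circle_int K r l -> Cmod l <= M * r * (2 * PI).
Proof.
intros Hr HM Hl; pose proof PI_RGT_0.
replace (M * r * (2 * PI)) with (M * r * (2 * PI - 0)) by ring.
refine (Cmod_CInt_le _ _ _ _ _ _ _ Hl); [lra|]; intros t Ht.
rewrite !Cmod_mult, Cmod_Ci, Cmod_Cpolar, Rabs_pos_eq by exact Hr.
rewrite Rmult_1_l; apply Rmult_le_compat_r; auto.
Qed.

Lemma Cmod_two_pi_i : Cmod two_pi_i = 2 * PI.
Proof.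
pose proof PI_RGT_0; unfold two_pi_i.
rewrite Cmod_mult, Cmod_Ci, Cmod_R, Rabs_pos_eq; lra.
Qed.

Lemma Cmod_inv_Cpolar (r t : R) : 0 < r -> Cmod (/ Cpolar r t) = / r.
Proof.
intros Hr; rewrite Cpolar_inv by exact Hr.
rewrite Cmod_Cpolar, Rabs_pos_eq; [reflexivity|]; apply Rlt_le, Rinv_0_lt_compat, Hr.
Qed.

(** Cauchy's estimate, with M a bound for |f| on |z| = r. Holding for every r < 1, it puts the
    radius of convergence at 1 or more. *)
Lemma taylor_coef_bound (r : R) : 0 < r < 1 ->
  exists M, forall n, Cmod (taylor_coef n) * r ^ n <= M.
Proof.
intros Hr; destruct (bounded_on_circle f r) as [M [HM0 HM]]; [lra|apply analytic_continuous|].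
exists M; intros n; pose proof PI_RGT_0.
assert (H1 : Cmod (two_pi_i * taylor_coef n) <= M * (/ r) ^ S n * r * (2 * PI)).
{ refine (Cmod_circle_int_le _ r _ _ _ _ (is_circle_int_taylor n r Hr)); [lra|]; intros t Ht.
  rewrite Cmod_mult, Cmod_pow, Cmod_inv_Cpolar by lra.
  apply Rmult_le_compat_r; auto; apply pow_le, Rlt_le, Rinv_0_lt_compat; lra. }
rewrite Cmod_mult, Cmod_two_pi_i in H1.
replace (M * (/ r) ^ S n * r * (2 * PI)) with ((2 * PI) * (M * (/ r) ^ n)) in H1
  by (simpl; field; lra).
apply Rmult_le_reg_l in H1; [|lra].
replace M with (M * (/ r) ^ n * r ^ n) at 1.
- apply Rmult_le_compat_r; [apply pow_le; lra|exact H1].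
- rewrite Rmult_assoc, <- Rpow_mult_distr, Rinv_l, pow1 by lra; ring.
Qed.

(** Filling in [f' z0] at [z0] makes the difference quotient continuous there, which is all that
    [circle_int_punctured] asks at the exceptional point. *)
Lemma divided_difference (z0 : C) : Cmod z0 < 1 -> exists H : C -> C,
  (forall z, (f z - f z0)%C = (H z * (z - z0))%C) /\
  (forall z, Cmod z < 1 -> Ccontinuous H z) /\
  (forall z, Cmod z < 1 -> z <> z0 -> exists l, is_Cderive H z l).
Proof.
intros Hz0.
set (H := fun z => if excluded_middle_informative (z = z0) then f' z0
  else ((f z - f z0) * / (z - z0))%C).
assert (Hne : forall z, z <> z0 -> (z - z0)%C <> 0).
{ intros z Hz E; apply Hz; replace z with (z - z0 + z0)%C by ring; rewrite E; ring. }
assert (HH : forall z, z <> z0 -> H z = ((f z - f z0) * / (z - z0))%C).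
{ intros z Hz; unfold H; now destruct (excluded_middle_informative _). }
assert (HH0 : H z0 = f' z0).
{ unfold H; now destruct (excluded_middle_informative _). }
assert (HD : forall z, Cmod z < 1 -> z <> z0 -> exists l, is_Cderive H z l).
{ intros z Hz Hzz; eexists.
  apply (is_derive_ext_loc (V := AbsRing_NormedModule C_AbsRing)
    (fun w => (f w - f z0) * / (w - z0))%C).
  - exists (mkposreal _ (proj1 (Cmod_gt_0 _) (Hne z Hzz))).
    change (forall w : C, Cmod (w - z) < Cmod (z - z0) -> ((f w - f z0) * / (w - z0))%C = H w).
    intros w Hw; symmetry; apply HH; intros ->.
    replace (z0 - z)%C with (- (z - z0))%C in Hw by ring; rewrite Cmod_opp in Hw; lra.
  - apply is_Cderive_mult; [apply is_Cderive_minus_const, analytic_is_Cderive, Hz|].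
    now apply is_Cderive_inv_minus. }
exists H; repeat split; [|intros z Hz|exact HD].
- intros z; destruct (excluded_middle_informative (z = z0)) as [->|Hz]; [ring|].
  rewrite HH by exact Hz; field; auto.
- destruct (excluded_middle_informative (z = z0)) as [->|Hzz].
  + apply Ccontinuous_eps; intros eps Heps.
    destruct (Hf z0 Hz (eps / 2)) as (delta & Hdelta & Hd); [lra|].
    exists delta; split; [exact Hdelta|]; intros w Hw.
    destruct (excluded_middle_informative (w = z0)) as [->|Hwz].
    { replace (H z0 - H z0)%C with (RtoC 0) by ring; now rewrite Cmod_0. }
    assert (Hpos : 0 < Cmod (w - z0)) by (apply Cmod_gt_0; auto).
    pose proof (Hd (w - z0)%C (conj Hpos Hw)) as Hd'.
    change (Cmod ((f (z0 + (w - z0))%C - f z0) - f' z0 * (w - z0)) <= eps / 2 * Cmod (w - z0)) in Hd'.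
    replace (z0 + (w - z0))%C with w in Hd' by ring.
    rewrite HH, HH0 by exact Hwz.
    replace ((f w - f z0) * / (w - z0) - f' z0)%C
      with (((f w - f z0) - f' z0 * (w - z0)) / (w - z0))%C by (field; auto).
    rewrite Cmod_div by auto.
    apply Rle_lt_trans with (eps / 2); [|lra].
    apply Rmult_le_reg_r with (Cmod (w - z0)); [exact Hpos|].
    unfold Rdiv at 1; rewrite Rmult_assoc, Rinv_l, Rmult_1_r by lra; exact Hd'.
  + destruct (HD z Hz Hzz) as [l Hl]; eapply is_Cderive_continuous, Hl.
Qed.

(** The finite geometric sum for 1 / (z - z0), in the multiplied form that fits f z - f z0 = H z (z
    - z0). *)
Lemma Csum_telescope (z z0 : C) (n : nat) : z <> 0 ->
  (Csum (fun k => z0 ^ k * (/ z) ^ S k) n * (z - z0))%C = (1 - (z0 / z) ^ n)%C.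
Proof.
intros Hz; induction n as [|n IH]; cbn [Csum]; [simpl; ring|].
rewrite Cmult_plus_distr_r, IH.
unfold Cdiv; rewrite !Cpow_mult_l, !Cpow_S; field_simplify; auto.
Qed.

(** The factor [f z] produces the Taylor coefficients. Against the constant [f z0] only the term 1/z
    survives, so [f z0] is subtracted exactly once. *)
Lemma is_circle_int_partial_sum (z0 : C) (r : R) (n : nat) : 0 < r < 1 ->
  is_circle_int (fun z => Csum (fun k => z0 ^ k * (/ z) ^ S k) (S n) * (f z - f z0))%C r
    (two_pi_i * (Csum (fun k => taylor_coef k * z0 ^ k) (S n) - f z0))%C.
Proof.
intros Hr.
assert (Hterm : forall k l, is_circle_int (fun z => (/ z) ^ S k)%C r l ->
  is_CInt (fun t => z0 ^ k * (f (Cpolar r t) * (/ Cpolar r t) ^ S k * (Ci * Cpolar r t) -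
    f z0 * ((/ Cpolar r t) ^ S k * (Ci * Cpolar r t))))%C 0 (2 * PI)
    (z0 ^ k * (two_pi_i * taylor_coef k - f z0 * l))%C).
{ intros k l Hl; apply is_CInt_Cmult_l.
  apply (is_CInt_minus); [now apply is_circle_int_taylor|].
  now apply is_CInt_Cmult_l. }
unfold is_circle_int; induction n as [|n IH].
- assert (H0 : is_circle_int (fun z => (/ z) ^ 1)%C r two_pi_i).
  { apply (is_CInt_ext (fun t => / Cpolar r t * (Ci * Cpolar r t))%C);
      [intros t; simpl; rewrite Cmult_1_r; reflexivity|apply is_circle_int_inv; lra]. }
  apply Hterm in H0; cbn [Csum].
  match goal with |- is_CInt _ _ _ ?l => match type of H0 with is_CInt _ _ _ ?l' =>
    replace l with l' by (simpl; ring) end end.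
  revert H0; apply is_CInt_ext; intros t; simpl; ring.
- pose proof (Hterm (S n) 0 (is_circle_int_inv_pow r n ltac:(lra))) as H1.
  pose proof (is_CInt_plus _ _ _ _ _ _ IH H1) as H2.
  match goal with |- is_CInt _ _ _ ?l => match type of H2 with is_CInt _ _ _ ?l' =>
    replace l with (l' : C) end end.
  + revert H2; apply is_CInt_ext; intros t.
    cbn [Csum]; ring.
  + cbn [Csum]; ring.
Qed.

(** [H] has integral 0. Subtracting the integral of H (z - z0) times the geometric sum leaves that
    of H (z0/z)^(n+1), which equals -2 pi i times the Taylor error and is geometrically small on |z|
    = r. *)
Lemma taylor_remainder (z0 : C) (r : R) : Cmod z0 < r < 1 ->
  exists M, forall n, Cmod (Csum (fun k => taylor_coef k * z0 ^ k)%C (S n) - f z0)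
    <= M * (Cmod z0 / r) ^ S n.
Proof.
intros Hr; pose proof (Cmod_ge_0 z0) as Hz0; pose proof PI_RGT_0 as HPI.
destruct (divided_difference z0) as (H & HH & Hc & Hd); [lra|].
destruct (bounded_on_circle H r) as [M [HM0 HM]]; [lra|exact Hc|].
exists (M * r); intros n.
assert (I0 : is_circle_int H r 0).
{ rewrite <- (circle_int_punctured H z0 r Hc Hd Hr).
  apply is_CInt_continuous; [lra|]; intros t _.
  apply continuous_Cmult; [|apply continuous_angular_tangent].
  apply (continuous_comp (fun t => Cpolar r t) H); [apply continuous_Cpolar_angle|].
  apply Hc; rewrite Cmod_Cpolar, Rabs_pos_eq; lra. }
assert (I1 := is_circle_int_partial_sum z0 r n ltac:(lra)).
set (D := (Csum (fun k => taylor_coef k * z0 ^ k)%C (S n) - f z0)%C) in *.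
assert (I2 : is_circle_int (fun z => H z * (z0 / z) ^ S n)%C r (0 - two_pi_i * D)%C).
{ pose proof (is_CInt_minus _ _ _ _ _ _ I0 I1) as I2.
  revert I2; apply is_CInt_ext; intros t.
  pose proof (Cpolar_neq_0 r t ltac:(lra)) as Hne.
  pose proof (Csum_telescope (Cpolar r t) z0 (S n) Hne) as T.
  rewrite HH.
  match goal with |- (?u - ?s * (?h * ?q) * ?v)%C = _ =>
    replace (s * (h * q) * v)%C with (s * q * (h * v))%C by ring end.
  rewrite T; ring. }
apply Cmod_circle_int_le with (M := M * (Cmod z0 / r) ^ S n) in I2; [|lra|].
- replace (0 - two_pi_i * D)%C with (- (two_pi_i * D))%C in I2 by ring.
  rewrite Cmod_opp, Cmod_mult, Cmod_two_pi_i in I2.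
  apply Rmult_le_reg_l with (2 * PI); [lra|]; lra.
- intros t Ht; rewrite Cmod_mult, Cmod_pow; unfold Cdiv.
  rewrite Cmod_mult, Cmod_inv_Cpolar by lra.
  apply Rmult_le_compat_r; [apply pow_le, Rle_div_r; lra|auto].
Qed.

End Taylor.

(** * Estimates for the derivative *)

Fixpoint Rsum (u : nat -> R) (n : nat) : R :=
  match n with O => 0 | S n => Rsum u n + u n end.

Lemma Rsum_le (u v : nat -> R) (n : nat) : (forall k, u k <= v k) -> Rsum u n <= Rsum v n.
Proof. intros H; induction n as [|n IH]; simpl; [lra|specialize (H n); lra]. Qed.

Lemma Rsum_mono (u : nat -> R) (n m : nat) : (forall k, 0 <= u k) -> (n <= m)%nat ->
  Rsum u n <= Rsum u m.
Proof. intros H Hnm; induction Hnm as [|m _ IH]; simpl; [lra|specialize (H m); lra]. Qed.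

Lemma Rsum_scal (c : R) (u : nat -> R) (n : nat) : Rsum (fun k => u k * c) n = Rsum u n * c.
Proof. induction n as [|n IH]; simpl; [ring|rewrite IH; ring]. Qed.

Lemma Rsum_shift (u : nat -> R) (n : nat) : Rsum u (S n) = u O + Rsum (fun k => u (S k)) n.
Proof. induction n as [|n IH]; [simpl; ring|]; cbn [Rsum] in *; rewrite IH; ring. Qed.

Lemma is_lim_seq_Rsum (u : nat -> R) (l : R) : is_series u l -> is_lim_seq (Rsum u) l.
Proof.
intros H; apply is_lim_seq_incr_1.
apply (is_lim_seq_ext (sum_n u)); [|exact H].
intros n; induction n as [|n IH]; [rewrite sum_O; simpl; ring|].
rewrite sum_Sn, IH; reflexivity.
Qed.

Lemma Rsum_le_series (u : nat -> R) (l : R) (n : nat) : (forall k, 0 <= u k) ->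
  is_series u l -> Rsum u n <= l.
Proof.
intros Hu H; apply is_lim_seq_Rsum in H.
refine (is_lim_seq_le_loc (fun _ => Rsum u n) (Rsum u) (Rsum u n) l _ (is_lim_seq_const _) H).
exists n; intros m Hm; now apply Rsum_mono.
Qed.

Lemma Cmod_Csum_le (u : nat -> C) (n : nat) : Cmod (Csum u n) <= Rsum (fun k => Cmod (u k)) n.
Proof.
induction n as [|n IH]; simpl; [rewrite Cmod_0; lra|].
eapply Rle_trans; [apply Cmod_triangle|lra].
Qed.

Lemma Csum_minus (u v : nat -> C) (n : nat) :
  (Csum u n - Csum v n)%C = Csum (fun k => u k - v k)%C n.
Proof. induction n as [|n IH]; simpl; [ring|rewrite <- IH; ring]. Qed.

Lemma Cmod_pow_diff_le (z w : C) (r : R) (k : nat) : Cmod z <= r -> Cmod w <= r ->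
  Cmod (w ^ k - z ^ k) <= INR k * r ^ pred k * Cmod (w - z).
Proof.
intros Hz Hw; pose proof (Cmod_ge_0 z) as H0; pose proof (Cmod_ge_0 (w - z)) as H1.
induction k as [|k IH].
- simpl; replace (1 - 1)%C with (RtoC 0) by ring; rewrite Cmod_0; lra.
- replace (w ^ S k - z ^ S k)%C with (w * (w ^ k - z ^ k) + z ^ k * (w - z))%C
    by (rewrite !Cpow_S; ring).
  eapply Rle_trans; [apply Cmod_triangle|]; rewrite !Cmod_mult, Cmod_pow, S_INR.
  assert (Hk : Cmod z ^ k <= r ^ k) by (apply pow_incr; lra).
  assert (Hr : 0 <= r ^ k) by (apply pow_le; lra).
  assert (H2 : Cmod w * Cmod (w ^ k - z ^ k) <= INR k * r ^ k * Cmod (w - z)).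
  { destruct k as [|k].
    - simpl; replace (1 - 1)%C with (RtoC 0) by ring; rewrite Cmod_0; lra.
    - apply Rle_trans with (r * (INR (S k) * r ^ pred (S k) * Cmod (w - z))).
      + apply Rmult_le_compat; auto using Cmod_ge_0.
      + apply Req_le; simpl pred; simpl pow; ring. }
  simpl pred; nra.
Qed.

Section PowerSeries.

Variables (a : nat -> C) (f f' : C -> C).

(** Coefficients of the majorant series: a real power series, to which the theory of [PSeries] and
    [CV_radius] applies. *)
Definition coef_mod (n : nat) : R := Cmod (a n).
(** It has n terms and is the derivative of the partial sum with n + 1 terms, hence [S n] in the
    lemmas below. *)
Definition deriv_partial (n : nat) (z : C) : C := Csum (fun k => RtoC (INR (S k)) * a (S k) * z ^ k)%C n.

Hypothesis Ha : forall r, 0 < r < 1 -> exists M, forall n, Cmod (a n) * r ^ n <= M.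
Hypothesis Hsum : forall z eps, Cmod z < 1 -> 0 < eps ->
  exists N, forall n, (N <= n)%nat -> Cmod (Csum (fun k => a k * z ^ k)%C n - f z) < eps.
Hypothesis Hf : analytic_on_disc f f'.

Lemma coef_mod_radius (r : R) : Rabs r < 1 -> Rbar_lt (Rabs r) (CV_radius coef_mod).
Proof.
intros Hr; set (s := (Rabs r + 1) / 2); pose proof (Rabs_pos r).
apply Rbar_lt_le_trans with s; [simpl; unfold s; lra|].
apply (CV_radius_bounded coef_mod).
destruct (Ha s) as [M HM]; [unfold s; lra|].
exists M; intros n; rewrite Rabs_pos_eq; [apply HM|].
apply Rmult_le_pos; [apply Cmod_ge_0|apply pow_le; unfold s; lra].
Qed.

Lemma PS_derive_coef_mod_ge_0 (n : nat) : 0 <= PS_derive coef_mod n.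
Proof. apply Rmult_le_pos; [apply pos_INR|apply Cmod_ge_0]. Qed.

Lemma is_series_PSeries (b : nat -> R) (r : R) : Rbar_lt (Rabs r) (CV_radius b) ->
  is_series (fun k => b k * r ^ k) (PSeries b r).
Proof. intros Hr; apply Series_correct, ex_series_Rabs, CV_disk_inside, Hr. Qed.

Lemma is_series_deriv (r : R) : 0 <= r < 1 ->
  is_series (fun k => PS_derive coef_mod k * r ^ k) (PSeries (PS_derive coef_mod) r).
Proof.
intros Hr; apply is_series_PSeries.
rewrite CV_radius_derive; apply coef_mod_radius; rewrite Rabs_pos_eq; lra.
Qed.

Lemma is_series_deriv2 (r : R) : 0 <= r < 1 ->
  is_series (fun k => PS_derive (PS_derive coef_mod) k * r ^ k)
    (PSeries (PS_derive (PS_derive coef_mod)) r).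
Proof.
intros Hr; apply is_series_PSeries.
rewrite !CV_radius_derive; apply coef_mod_radius; rewrite Rabs_pos_eq; lra.
Qed.

(** On |z| <= r this is a Lipschitz constant for f minus its partial sum with n + 1 terms. *)
Definition deriv_tail (n : nat) (r : R) : R :=
  PSeries (PS_derive coef_mod) r - Rsum (fun k => PS_derive coef_mod k * r ^ k) n.

Lemma deriv_tail_lim (r : R) : 0 <= r < 1 -> is_lim_seq (fun n => deriv_tail n r) 0.
Proof.
intros Hr; pose proof (is_lim_seq_Rsum _ _ (is_series_deriv r Hr)) as H.
pose proof (is_lim_seq_minus' _ _ _ _ (is_lim_seq_const (PSeries (PS_derive coef_mod) r)) H) as H1.
now rewrite Rminus_diag in H1.
Qed.

Lemma Cmod_partial_sum_diff_le (z w : C) (r : R) (n m : nat) : (n <= m)%nat ->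
  0 <= r < 1 -> Cmod z <= r -> Cmod w <= r ->
  Cmod ((Csum (fun k => a k * w ^ k) (S m) - Csum (fun k => a k * z ^ k) (S m)) -
        (Csum (fun k => a k * w ^ k) (S n) - Csum (fun k => a k * z ^ k) (S n)))%C
    <= deriv_tail n r * Cmod (w - z).
Proof.
intros Hnm Hr Hz Hw; pose proof (Cmod_ge_0 (w - z)) as H0.
apply Rle_trans with ((Rsum (fun k => PS_derive coef_mod k * r ^ k) m -
  Rsum (fun k => PS_derive coef_mod k * r ^ k) n) * Cmod (w - z)).
- induction Hnm as [|m Hnm IH].
  + match goal with |- Cmod ?u <= _ => replace u with (RtoC 0) by ring end.
    rewrite Cmod_0; lra.
  + cbn [Csum Rsum] in *.
    match goal with |- Cmod (?u + ?p - (?v + ?q) - ?d) <= _ =>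
      replace (u + p - (v + q) - d)%C with ((u - v - d) + (p - q))%C by ring end.
    eapply Rle_trans; [apply Cmod_triangle|].
    replace (a (S m) * w ^ S m - a (S m) * z ^ S m)%C
      with (a (S m) * (w ^ S m - z ^ S m))%C by ring.
    rewrite Cmod_mult.
    assert (H1 : Cmod (a (S m)) * Cmod (w ^ S m - z ^ S m)
      <= PS_derive coef_mod m * r ^ m * Cmod (w - z)).
    { replace (PS_derive coef_mod m * r ^ m * Cmod (w - z))
        with (Cmod (a (S m)) * (INR (S m) * r ^ pred (S m) * Cmod (w - z)))
        by (unfold PS_derive, coef_mod; simpl pred; ring).
      apply Rmult_le_compat_l; [apply Cmod_ge_0|now apply Cmod_pow_diff_le]. }
    lra.
- apply Rmult_le_compat_r; [exact H0|]; unfold deriv_tail.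
  apply Rplus_le_compat_r, Rsum_le_series; [|now apply is_series_deriv].
  intros k; apply Rmult_le_pos; [apply PS_derive_coef_mod_ge_0|apply pow_le; lra].
Qed.

Lemma Cmod_function_diff_le (z w : C) (r : R) (n : nat) :
  0 <= r < 1 -> Cmod z <= r -> Cmod w <= r ->
  Cmod ((f w - f z) -
        (Csum (fun k => a k * w ^ k) (S n) - Csum (fun k => a k * z ^ k) (S n)))%C
    <= deriv_tail n r * Cmod (w - z).
Proof.
intros Hr Hz Hw; apply Rle_plus_epsilon; intros eps Heps.
destruct (Hsum z (eps / 2)) as [N1 H1]; [lra|lra|].
destruct (Hsum w (eps / 2)) as [N2 H2]; [lra|lra|].
set (m := (N1 + N2 + n)%nat).
specialize (H1 (S m) ltac:(unfold m; lia)); specialize (H2 (S m) ltac:(unfold m; lia)).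
pose proof (Cmod_partial_sum_diff_le z w r n m ltac:(unfold m; lia) Hr Hz Hw) as H3.
set (sw := Csum (fun k => a k * w ^ k)%C (S m)) in *.
set (sz := Csum (fun k => a k * z ^ k)%C (S m)) in *.
match goal with |- Cmod (_ - ?d) <= _ =>
  replace (f w - f z - d)%C with ((sw - sz - d) + (- (sw - f w) + (sz - f z)))%C by ring end.
eapply Rle_trans; [apply Cmod_triangle|]; apply Rplus_le_compat; [exact H3|].
eapply Rle_trans; [apply Cmod_triangle|]; rewrite Cmod_opp; lra.
Qed.

Lemma is_Cderive_partial_sum (n : nat) (z : C) :
  is_Cderive (fun w => Csum (fun k => a k * w ^ k) (S n))%C z (deriv_partial n z).
Proof.
assert (Hpow : forall k, is_Cderive (fun w => w ^ S k)%C z (RtoC (INR (S k)) * z ^ k)%C).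
{ intros k; induction k as [|k IH].
  - apply (is_derive_ext (V := AbsRing_NormedModule C_AbsRing) (fun w => w)).
    + intros t; symmetry; apply Cpow_1_r.
    + replace (RtoC (INR 1) * z ^ 0)%C with (RtoC 1) by (simpl; ring).
      apply (is_derive_id (z : C_AbsRing)).
  - pose proof (is_Cderive_mult _ _ _ _ _ (is_derive_id (z : C_AbsRing)) IH) as H.
    replace (RtoC (INR (S (S k))) * z ^ S k)%C
      with (RtoC 1 * z ^ S k + z * (RtoC (INR (S k)) * z ^ k))%C; [exact H|].
    rewrite (S_INR (S k)), RtoC_plus, (Cpow_S z k); ring. }
induction n as [|n IH].
- apply (is_derive_ext (V := AbsRing_NormedModule C_AbsRing) (fun _ => a O)).
  + intros t; simpl; change (a 0%nat = (0 + a 0%nat * 1)%C); ring.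
  + apply (is_derive_const (V := AbsRing_NormedModule C_AbsRing)).
- pose proof (is_Cderive_mult _ _ _ _ _
    (is_derive_const (V := AbsRing_NormedModule C_AbsRing) (a (S n)) z) (Hpow n)) as H.
  pose proof (is_derive_plus (V := AbsRing_NormedModule C_AbsRing) _ _ _ _ _ IH H) as H1.
  unfold deriv_partial in *; cbn [Csum] in *.
  match type of H1 with is_derive _ _ ?l => replace (Csum (fun k => RtoC (INR (S k)) * a (S k) * z ^ k) n +
    RtoC (INR (S n)) * a (S n) * z ^ n)%C with (l : C); [exact H1|] end.
  change plus with Cplus; change zero with (RtoC 0); ring.
Qed.

(** Termwise differentiation: a Lipschitz constant of a function bounds its derivative, applied to f
    minus its partial sum. One small real increment [h] suffices, and |z| < r leaves room for z + h
    in the disc of radius r. *)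
Lemma Cmod_deriv_minus_partial_le (z : C) (r : R) (n : nat) : Cmod z < r < 1 ->
  Cmod (f' z - deriv_partial n z) <= deriv_tail n r.
Proof.
intros Hr; pose proof (Cmod_ge_0 z) as Hz0.
apply Rle_plus_epsilon; intros eps Heps.
destruct (Hf z ltac:(change (Cmod z < 1); lra) (eps / 2)) as (d1 & Hd1 & H1); [lra|].
pose proof (is_Cderive_partial_sum n z) as HP; apply has_cderiv_is_Cderive in HP.
destruct (HP (eps / 2)) as (d2 & Hd2 & H2); [lra|].
set (d := Rmin (Rmin d1 d2) (r - Cmod z) / 2).
assert (Hd : 0 < d) by (unfold d; apply Rdiv_lt_0_compat; [repeat apply Rmin_pos|]; lra).
assert (Hd1' : d < d1 /\ d < d2 /\ d < r - Cmod z).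
{ pose proof (Rmin_l (Rmin d1 d2) (r - Cmod z)); pose proof (Rmin_r (Rmin d1 d2) (r - Cmod z)).
  pose proof (Rmin_l d1 d2); pose proof (Rmin_r d1 d2); unfold d in *; lra. }
set (h := RtoC d).
assert (Hh : Cmod h = d) by (unfold h; rewrite Cmod_R, Rabs_pos_eq; lra).
assert (J1 := H1 h ltac:(change (0 < Cmod h < d1); lra)).
assert (J2 := H2 h ltac:(change (0 < Cmod h < d2); lra)).
set (P := fun w => Csum (fun k => a k * w ^ k)%C (S n)) in *.
change (Cmod ((f (z + h)%C - f z) - f' z * h) <= eps / 2 * Cmod h) in J1.
change (Cmod ((P (z + h)%C - P z) - deriv_partial n z * h) <= eps / 2 * Cmod h) in J2.
assert (J3 : Cmod ((f (z + h)%C - f z) - (P (z + h)%C - P z)) <= deriv_tail n r * Cmod (z + h - z)).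
{ apply Cmod_function_diff_le; try lra.
  eapply Rle_trans; [apply Cmod_triangle|lra]. }
replace (z + h - z)%C with h in J3 by ring.
apply Rmult_le_reg_r with (Cmod h); [lra|]; rewrite <- Cmod_mult.
match type of J1 with Cmod ?u <= _ => set (u1 := u) in * end.
match type of J2 with Cmod ?u <= _ => set (u2 := u) in * end.
match type of J3 with Cmod ?u <= _ => set (u3 := u) in * end.
replace ((f' z - deriv_partial n z) * h)%C with (u3 + (u2 + - u1))%C
  by (unfold u1, u2, u3; ring).
eapply Rle_trans; [apply Cmod_triangle|].
pose proof (Cmod_triangle u2 (- u1)) as T; rewrite Cmod_opp in T; lra.
Qed.

Lemma Cmod_deriv_partial_le (z : C) (r : R) (n : nat) : Cmod z <= r < 1 ->
  Cmod (deriv_partial n z) <= PSeries (PS_derive coef_mod) r.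
Proof.
intros Hr; pose proof (Cmod_ge_0 z) as Hz0.
eapply Rle_trans; [apply Cmod_Csum_le|].
eapply Rle_trans; [|apply (Rsum_le_series (fun k => PS_derive coef_mod k * r ^ k) _ n);
  [|apply is_series_deriv; lra]].
- apply Rsum_le; intros k; rewrite !Cmod_mult, Cmod_R, Cmod_pow, Rabs_pos_eq by apply pos_INR.
  apply Rmult_le_compat_l; [apply PS_derive_coef_mod_ge_0|apply pow_incr; lra].
- intros k; apply Rmult_le_pos; [apply PS_derive_coef_mod_ge_0|apply pow_le; lra].
Qed.

Lemma Cmod_deriv_le (z : C) (r : R) : Cmod z <= r < 1 ->
  Cmod (f' z) <= PSeries (PS_derive coef_mod) r.
Proof.
intros Hr; pose proof (Cmod_ge_0 z) as Hz0.
(* The truncation error is controlled at radii strictly above |z|, hence [s]; it tends to 0 with n,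
   so the final bound stays at r. *)
set (s := (r + 1) / 2).
assert (H : forall n, Cmod (f' z) <= PSeries (PS_derive coef_mod) r + deriv_tail n s).
{ intros n; replace (f' z) with (deriv_partial n z + (f' z - deriv_partial n z))%C by ring.
  eapply Rle_trans; [apply Cmod_triangle|]; apply Rplus_le_compat.
  - now apply Cmod_deriv_partial_le.
  - apply Cmod_deriv_minus_partial_le; unfold s; lra. }
pose proof (is_lim_seq_plus' _ _ _ _ (is_lim_seq_const (PSeries (PS_derive coef_mod) r))
  (deriv_tail_lim s ltac:(unfold s; lra))) as L.
rewrite Rplus_0_r in L.
exact (is_lim_seq_le _ _ (Cmod (f' z)) _ H (is_lim_seq_const _) L).
Qed.

(** Source of the continuity of [f'] and of the existence of the area integrals. The constant is the
    majorant of the second derivative. *)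
Lemma deriv_Lipschitz (z w : C) (r : R) : Cmod z <= r -> Cmod w <= r -> r < 1 ->
  Cmod (f' w - f' z) <= PSeries (PS_derive (PS_derive coef_mod)) r * Cmod (w - z).
Proof.
intros Hz Hw Hr; pose proof (Cmod_ge_0 z) as Hz0; pose proof (Cmod_ge_0 (w - z)) as H0.
set (s := (r + 1) / 2).
set (L := PSeries (PS_derive (PS_derive coef_mod)) r).
assert (HL : forall n, Rsum (fun k => PS_derive (PS_derive coef_mod) k * r ^ k) n <= L).
{ intros n; apply Rsum_le_series; [|apply is_series_deriv2; lra].
  intros k; apply Rmult_le_pos; [|apply pow_le; lra].
  apply Rmult_le_pos; [apply pos_INR|apply PS_derive_coef_mod_ge_0]. }
assert (HP : forall n, Cmod (deriv_partial n w - deriv_partial n z) <= L * Cmod (w - z)).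
{ intros n; destruct n as [|n].
  { unfold deriv_partial; cbn [Csum]; replace (0 - 0)%C with (RtoC 0) by ring; rewrite Cmod_0.
    apply Rmult_le_pos; [exact (HL O)|exact H0]. }
  unfold deriv_partial; rewrite Csum_minus.
  eapply Rle_trans; [apply Cmod_Csum_le|].
  apply Rle_trans with (Rsum (fun k => INR k * PS_derive coef_mod k * r ^ pred k) (S n) * Cmod (w - z)).
  - rewrite <- Rsum_scal; apply Rsum_le; intros k.
    replace (RtoC (INR (S k)) * a (S k) * w ^ k - RtoC (INR (S k)) * a (S k) * z ^ k)%C
      with (RtoC (INR (S k)) * a (S k) * (w ^ k - z ^ k))%C by ring.
    rewrite !Cmod_mult, Cmod_R, Rabs_pos_eq by apply pos_INR.
    replace (INR k * PS_derive coef_mod k * r ^ pred k * Cmod (w - z))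
      with (PS_derive coef_mod k * (INR k * r ^ pred k * Cmod (w - z))) by ring.
    apply Rmult_le_compat_l; [apply PS_derive_coef_mod_ge_0|now apply Cmod_pow_diff_le].
  - apply Rmult_le_compat_r; [exact H0|].
    (* The term k = 0 vanishes; shifting the others gives the coefficients of the second derived
       series. *)
    rewrite Rsum_shift; simpl INR at 1; rewrite !Rmult_0_l, Rplus_0_l.
    exact (HL n). }
assert (H : forall n, Cmod (f' w - f' z) <= L * Cmod (w - z) + (deriv_tail n s + deriv_tail n s)).
{ intros n.
  replace (f' w - f' z)%C with ((deriv_partial n w - deriv_partial n z) +
    ((f' w - deriv_partial n w) + - (f' z - deriv_partial n z)))%C by ring.
  eapply Rle_trans; [apply Cmod_triangle|]; apply Rplus_le_compat; [apply HP|].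
  eapply Rle_trans; [apply Cmod_triangle|]; rewrite Cmod_opp.
  apply Rplus_le_compat; apply Cmod_deriv_minus_partial_le; unfold s; lra. }
pose proof (deriv_tail_lim s ltac:(unfold s; lra)) as T.
pose proof (is_lim_seq_plus' _ _ _ _ (is_lim_seq_const (L * Cmod (w - z)))
  (is_lim_seq_plus' _ _ _ _ T T)) as LL.
rewrite !Rplus_0_r in LL.
exact (is_lim_seq_le _ _ (Cmod (f' w - f' z)) _ H (is_lim_seq_const _) LL).
Qed.

End PowerSeries.

(** * Area integrals *)

(** Integrability excludes the default branch, and the value does not depend on the integrability
    proof picked by [epsilon]. *)
Lemma Defs_RInt_unique (g : R -> R) (a b l : R) : is_RInt g a b l -> Defs.RInt g a b = l.
Proof.
intros H; unfold Defs.RInt.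
destruct (excluded_middle_informative _) as [Hi|Hn].
- rewrite <- RInt_Reals; now apply is_RInt_unique.
- exfalso; apply Hn; constructor; apply ex_RInt_Reals_0; now exists l.
Qed.

(** Relational counterpart of [area_upto]: both iterated integrals must exist, so the default value
    0 cannot interfere with linearity or comparison. *)
Definition is_area (g : C -> R) (R0 v : R) : Prop :=
  exists inner : R -> R, (forall t, is_RInt (fun r => g (Cpolar r t) * r) 0 R0 (inner t)) /\
    is_RInt inner 0 (2 * PI) v.

Lemma is_area_plus (g h : C -> R) (R0 v w : R) :
  is_area g R0 v -> is_area h R0 w -> is_area (fun z => g z + h z) R0 (v + w).
Proof.
intros (i & Hi & Hv) (j & Hj & Hw); exists (fun t => i t + j t); split.
- intros t; apply (is_RInt_ext (fun r => plus (g (Cpolar r t) * r) (h (Cpolar r t) * r))).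
  + intros r _; unfold plus; simpl; ring.
  + apply (is_RInt_plus (V := R_NormedModule)); auto.
- now apply (is_RInt_plus (V := R_NormedModule)).
Qed.

Lemma is_area_scal (g : C -> R) (R0 v c : R) :
  is_area g R0 v -> is_area (fun z => c * g z) R0 (c * v).
Proof.
intros (i & Hi & Hv); exists (fun t => c * i t); split.
- intros t; apply (is_RInt_ext (fun r => scal c (g (Cpolar r t) * r))).
  + intros r _; unfold scal; simpl; unfold mult; simpl; ring.
  + now apply (is_RInt_scal (V := R_NormedModule)).
- now apply (is_RInt_scal (V := R_NormedModule)).
Qed.

Lemma is_area_ext (g h : C -> R) (R0 v : R) :
  (forall r t, g (Cpolar r t) = h (Cpolar r t)) -> is_area g R0 v -> is_area h R0 v.
Proof.
intros H (i & Hi & Hv); exists i; split; [|exact Hv].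
intros t; apply (is_RInt_ext (fun r => g (Cpolar r t) * r)); [|apply Hi].
intros r _; now rewrite H.
Qed.

Lemma is_area_le (g h : C -> R) (R0 v w : R) : 0 <= R0 ->
  (forall z, Cmod z <= R0 -> g z <= h z) -> is_area g R0 v -> is_area h R0 w -> v <= w.
Proof.
intros HR H (i & Hi & Hv) (j & Hj & Hw); pose proof PI_RGT_0.
apply (is_RInt_le i j 0 (2 * PI)); auto; [lra|]; intros t _.
apply (is_RInt_le (fun r => g (Cpolar r t) * r) (fun r => h (Cpolar r t) * r) 0 R0); auto.
intros r Hr; apply Rmult_le_compat_r; [lra|]; apply H.
rewrite Cmod_Cpolar, Rabs_pos_eq; lra.
Qed.

Lemma is_RInt_pow_mul (m : nat) (c R0 : R) :
  is_RInt (fun r => r ^ m * c * r) 0 R0 (c * (R0 ^ S (S m) / INR (S (S m)))).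
Proof.
assert (Hm : INR (S (S m)) <> 0) by (apply not_0_INR; lia).
replace (c * (R0 ^ S (S m) / INR (S (S m)))) with
  (minus (c * (R0 ^ S (S m) / INR (S (S m)))) (c * (0 ^ S (S m) / INR (S (S m)))))
  by (unfold minus, plus, opp; simpl pow; simpl AbelianGroup.sort in *; simpl; field; exact Hm).
apply (is_RInt_derive (V := R_CompleteNormedModule)
  (fun r => c * (r ^ S (S m) / INR (S (S m)))) (fun r => r ^ m * c * r)).
- intros r _; auto_derive; [trivial|].
  change (match m with O => 1 | S _ => INR m + 1 end + 1) with (INR (S (S m))); field; exact Hm.
- intros r _; apply (ex_derive_continuous (K := R_AbsRing) (V := R_NormedModule)); auto_derive; trivial.
Qed.

Lemma is_area_radial (m : nat) (c R0 : R) :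
  is_area (fun z => Cmod z ^ (2 * m) * c) R0 (2 * PI * c * (R0 ^ (2 * m + 2) / INR (2 * m + 2))).
Proof.
replace (2 * m + 2)%nat with (S (S (2 * m))) by lia.
exists (fun _ => c * (R0 ^ S (S (2 * m)) / INR (S (S (2 * m))))); split.
- intros t; eapply is_RInt_ext; [|apply is_RInt_pow_mul].
  intros r _; cbv beta; rewrite Cmod_Cpolar, !pow_mult, pow2_abs; reflexivity.
- replace (2 * PI * c * (R0 ^ S (S (2 * m)) / INR (S (S (2 * m))))) with
    (scal (2 * PI - 0) (c * (R0 ^ S (S (2 * m)) / INR (S (S (2 * m))))))
    by (unfold scal; simpl; unfold mult; simpl; ring).
  apply (is_RInt_const (V := R_NormedModule)).
Qed.

(** The angular factor is exp(i (n - m) t) with n - m >= 1, whose primitive is periodic. *)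
Lemma is_area_orthogonal (c : C) (n m : nat) (R0 : R) : (m < n)%nat ->
  is_area (fun z => fst (c * z ^ n * Cconj (z ^ m))%C) R0 0.
Proof.
intros Hmn; set (j := INR (n - m)); assert (Hj : 0 < j) by (apply lt_0_INR; lia).
set (K := R0 ^ S (S (n + m)) / INR (S (S (n + m)))).
exists (fun t => (fst c * cos (j * t) - snd c * sin (j * t)) * K); split.
- intros t; eapply is_RInt_ext; [|apply is_RInt_pow_mul].
  intros r _; cbv beta; rewrite !Cpolar_pow.
  replace (j * t) with (INR n * t - INR m * t) by (unfold j; rewrite minus_INR by lia; ring).
  unfold Cpolar, Cconj, Cmult; simpl; rewrite cos_minus, sin_minus, pow_add; ring.
- pose (F := fun t => (fst c * sin (j * t) + snd c * cos (j * t)) / j * K).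
  replace 0 with (minus (F (2 * PI)) (F 0)) at 2.
  + apply (is_RInt_derive (V := R_CompleteNormedModule) F).
    * intros t _; unfold F; auto_derive; [trivial|field; lra].
    * intros t _; apply (ex_derive_continuous (K := R_AbsRing) (V := R_NormedModule)).
      auto_derive; trivial.
  + unfold F; replace (j * (2 * PI)) with (0 + 2 * INR (n - m) * PI) by (unfold j; ring).
    rewrite cos_period, sin_period, Rmult_0_r; unfold minus, plus, opp; simpl; ring.
Qed.

Lemma is_area_cross (b : nat -> C) (c : C) (n m : nat) (R0 : R) : (m <= n)%nat ->
  is_area (fun z => fst (c * z ^ n * Cconj (Csum (fun k => b k * z ^ k) m))%C) R0 0.
Proof.
intros Hmn; induction m as [|m IH].
- eapply is_area_ext; [|
    replace 0 with (0 * (2 * PI * 0 * (R0 ^ (2 * 0 + 2) / INR (2 * 0 + 2)))) by ring;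
    apply is_area_scal, is_area_radial].
  intros r t; cbv beta; cbn [Csum]; unfold Cmult, Cconj; simpl; ring.
- specialize (IH ltac:(lia)).
  pose proof (is_area_plus _ _ _ _ _ IH (is_area_orthogonal (c * Cconj (b m)) n m R0 ltac:(lia))) as H.
  rewrite Rplus_0_r in H; revert H; apply is_area_ext; intros r t.
  cbn [Csum]; rewrite Cplus_conj, Cmult_conj.
  set (z := Cpolar r t : C) in *; change (Cpolar r t) with z.
  generalize (z ^ n)%C (Cconj (z ^ m)) (Cconj (Csum (fun k => b k * z ^ k)%C m)) (Cconj (b m)).
  intros p q s u; unfold Cmult, Cplus; simpl; ring.
Qed.

Lemma Cmod2_plus (z w : C) : Cmod (z + w) ^ 2 = Cmod z ^ 2 + (Cmod w ^ 2 + 2 * fst (w * Cconj z)%C).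
Proof.
unfold Cmod; rewrite !pow2_sqrt by (apply Rplus_le_le_0_compat; apply pow2_ge_0).
unfold Cmult, Cconj, Cplus; simpl; ring.
Qed.

(** Parseval's identity, one monomial at a time: the new one meets only lower powers in the cross
    term, which integrates to 0. *)
Lemma is_area_polynomial (b : nat -> C) (n : nat) (R0 : R) :
  is_area (fun z => Cmod (Csum (fun k => b k * z ^ k)%C n) ^ 2) R0
    (Rsum (fun k => 2 * PI * Cmod (b k) ^ 2 * (R0 ^ (2 * k + 2) / INR (2 * k + 2))) n).
Proof.
induction n as [|n IH].
- eapply is_area_ext; [|
    replace (Rsum _ 0) with (2 * PI * 0 * (R0 ^ (2 * 0 + 2) / INR (2 * 0 + 2))) by (simpl; field);
    apply is_area_radial].
  intros r t; cbv beta; cbn [Csum]; rewrite Cmod_0; ring.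
- pose proof (is_area_plus _ _ _ _ _ IH (is_area_plus _ _ _ _ _
    (is_area_radial n (Cmod (b n) ^ 2) R0)
    (is_area_scal _ _ _ 2 (is_area_cross b (b n) n n R0 (le_n n))))) as H.
  cbn [Rsum]; rewrite Rmult_0_r, Rplus_0_r in H; revert H; apply is_area_ext; intros r t.
  cbn [Csum]; rewrite Cmod2_plus, Cmod_mult, Cmod_pow, Rpow_mult_distr, <- pow_mult.
  rewrite (Nat.mul_comm n 2); ring.
Qed.

Lemma area_upto_eq (f' : C -> C) (R0 v : R) :
  is_area (fun z => Cmod (f' z) ^ 2) R0 v -> area_upto f' R0 = v.
Proof.
intros (i & Hi & Hv); apply Defs_RInt_unique.
apply (is_RInt_ext i); [|exact Hv].
intros t _; symmetry; apply Defs_RInt_unique, Hi.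
Qed.

Lemma Rabs_Cmod2_diff_le (z w : C) (B : R) : Cmod z <= B -> Cmod w <= B ->
  Rabs (Cmod z ^ 2 - Cmod w ^ 2) <= 2 * B * Cmod (z - w).
Proof.
intros Hz Hw; pose proof (Cmod_ge_0 z); pose proof (Cmod_ge_0 w); pose proof (Cmod_ge_0 (z - w)).
assert (Htri : Rabs (Cmod z - Cmod w) <= Cmod (z - w)).
{ pose proof (Cmod_triangle (z - w) w) as T1; pose proof (Cmod_triangle (- (z - w)) z) as T2.
  replace (z - w + w)%C with z in T1 by ring; replace (- (z - w) + z)%C with w in T2 by ring.
  rewrite Cmod_opp in T2; apply Rabs_le; lra. }
replace (Cmod z ^ 2 - Cmod w ^ 2) with ((Cmod z + Cmod w) * (Cmod z - Cmod w)) by ring.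
rewrite Rabs_mult, (Rabs_pos_eq (Cmod z + Cmod w)) by lra.
apply Rmult_le_compat; try lra; apply Rabs_pos.
Qed.

(** The inner integral exists by continuity along radii and is Lipschitz in the angle, so the outer
    one exists too. *)
Lemma is_area_exists (f' : C -> C) (R0 B L : R) : 0 < R0 < 1 ->
  (forall z, Cmod z <= R0 -> Cmod (f' z) <= B) ->
  (forall z w, Cmod z <= R0 -> Cmod w <= R0 -> Cmod (f' w - f' z) <= L * Cmod (w - z)) ->
  (forall z, Cmod z < 1 -> Ccontinuous f' z) ->
  exists v, is_area (fun z => Cmod (f' z) ^ 2) R0 v.
Proof.
intros HR HB HL Hc.
set (g := fun t r => Cmod (f' (Cpolar r t)) ^ 2 * r).
assert (Hg : forall t, ex_RInt (g t) 0 R0).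
{ intros t; apply (ex_RInt_continuous (V := R_CompleteNormedModule)).
  rewrite Rmin_left, Rmax_right by lra; intros r Hr.
  assert (H : continuous (fun r => Cmod (f' (Cpolar r t))) r).
  { apply (continuous_ext (fun r => norm (f' (Cpolar r t) : C_R_NormedModule))).
    - intros x; symmetry; apply Cmod_norm.
    - apply (continuous_comp (fun r => f' (Cpolar r t)) (norm (V := C_R_NormedModule))).
      + apply (continuous_comp (fun r => Cpolar r t) f'); [apply continuous_Cpolar_radius|].
        apply Hc; rewrite Cmod_Cpolar, Rabs_pos_eq; lra.
      + apply (filterlim_norm (V := C_R_NormedModule)). }
  apply (continuous_mult (K := R_AbsRing)); [|apply continuous_id].
  apply (continuous_ext (fun r => mult (Cmod (f' (Cpolar r t))) (Cmod (f' (Cpolar r t))))).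
  - intros x; unfold mult; simpl; ring.
  - now apply (continuous_mult (K := R_AbsRing)). }
set (i := fun t => RInt (g t) 0 R0).
assert (Hi : forall t, is_RInt (g t) 0 R0 (i t)) by (intros t; apply (RInt_correct (V := R_CompleteNormedModule)), Hg).
assert (HB0 : 0 <= B) by (eapply Rle_trans; [apply Cmod_ge_0|apply (HB 0); rewrite Cmod_0; lra]).
(* Lipschitz constant of |f'|^2 from |u^2 - v^2| = (u + v) |u - v|; the sign of [L] is not assumed,
   and the factors r and R0 are at most 1. *)
set (M := 2 * B * Rabs L).
assert (HM : 0 <= M) by (apply Rmult_le_pos; [lra|apply Rabs_pos]).
assert (Hlip : forall s t, Rabs (i s - i t) <= M * Rabs (s - t)).
{ intros s t.
  assert (H : is_RInt (fun r => minus (g s r) (g t r)) 0 R0 (minus (i s) (i t)))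
    by now apply (is_RInt_minus (V := R_NormedModule)).
  apply Rle_trans with (M * Rabs (s - t) * (R0 - 0));
    [|assert (0 <= M * Rabs (s - t)) by (apply Rmult_le_pos; [exact HM|apply Rabs_pos]); nra].
  replace (M * Rabs (s - t) * (R0 - 0)) with (scal (R0 - 0) (M * Rabs (s - t)))
    by (unfold scal; simpl; unfold mult; simpl; ring).
  apply (norm_RInt_le (V := R_NormedModule) (fun r => minus (g s r) (g t r))
    (fun _ => M * Rabs (s - t)) 0 R0 (minus (i s) (i t))); [lra| |exact H|apply (is_RInt_const (V := R_NormedModule))].
  intros r Hr.
  change (Rabs (g s r - g t r) <= M * Rabs (s - t)); unfold g.
  assert (Hs : Cmod (Cpolar r s) <= R0) by (rewrite Cmod_Cpolar, Rabs_pos_eq; lra).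
  assert (Ht : Cmod (Cpolar r t) <= R0) by (rewrite Cmod_Cpolar, Rabs_pos_eq; lra).
  pose proof (Rabs_Cmod2_diff_le _ _ _ (HB _ Hs) (HB _ Ht)) as H1.
  pose proof (HL _ _ Ht Hs) as H2.
  pose proof (Cpolar_Lipschitz r r s t ltac:(rewrite Rabs_pos_eq; lra)) as H3.
  rewrite Rminus_diag, Rabs_R0, Rplus_0_l in H3.
  rewrite <- Rmult_minus_distr_r, Rabs_mult, (Rabs_pos_eq r) by lra.
  set (X := Rabs (Cmod (f' (Cpolar r s)) ^ 2 - Cmod (f' (Cpolar r t)) ^ 2)) in *.
  assert (HX : X <= M * Rabs (s - t)).
  { eapply Rle_trans; [exact H1|]; unfold M; rewrite (Rmult_assoc (2 * B)).
    apply Rmult_le_compat_l; [lra|]; eapply Rle_trans; [exact H2|].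
    pose proof (Rle_abs L); pose proof (Cmod_ge_0 (Cpolar r s - Cpolar r t)).
    apply Rle_trans with (Rabs L * Cmod (Cpolar r s - Cpolar r t)).
    - apply Rmult_le_compat_r; assumption.
    - apply Rmult_le_compat_l; [apply Rabs_pos|assumption]. }
  assert (0 <= X) by apply Rabs_pos; nra. }
assert (Hic : ex_RInt i 0 (2 * PI)).
{ apply (ex_RInt_continuous (V := R_CompleteNormedModule)); intros t _.
  apply continuity_pt_filterlim; intros eps Heps.
  exists (eps / (M + 1)); split; [apply Rdiv_lt_0_compat; lra|]; intros s [_ Hs].
  simpl in Hs |- *; unfold R_dist in *.
  eapply Rle_lt_trans; [apply Hlip|].
  apply Rmult_lt_compat_r with (r := M + 1) in Hs; [|lra].
  unfold Rdiv in Hs; rewrite Rmult_assoc, Rinv_l, Rmult_1_r in Hs by lra.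
  pose proof (Rabs_pos (s - t)); nra. }
destruct Hic as [v Hv]; exists v, i; split; [|exact Hv].
exact Hi.
Qed.

(** * The Dirichlet sum *)

Lemma taylor_converges (f f' : C -> C) : analytic_on_disc f f' ->
  forall z eps, Cmod z < 1 -> 0 < eps -> exists N, forall n, (N <= n)%nat ->
    Cmod (Csum (fun k => taylor_coef f k * z ^ k)%C n - f z) < eps.
Proof.
intros Hf z eps Hz Heps; pose proof (Cmod_ge_0 z) as H0.
set (r := (Cmod z + 1) / 2).
destruct (taylor_remainder f f' Hf z r) as [M HM]; [unfold r; lra|].
assert (Hq : 0 <= Cmod z / r < 1).
{ split; [apply Rdiv_le_0_compat; unfold r; lra|apply Rlt_div_l; unfold r; lra]. }
set (q := Cmod z / r) in *; pose proof (Rabs_pos M) as HM0.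
destruct (pow_lt_1_zero q) with (y := eps / (Rabs M + 1)) as [N HN].
{ rewrite Rabs_pos_eq; lra. }
{ apply Rdiv_lt_0_compat; lra. }
exists (S N); intros [|n] Hn; [lia|].
eapply Rle_lt_trans; [apply HM|].
specialize (HN (S n) ltac:(lia)); rewrite Rabs_pos_eq in HN by (apply pow_le; lra).
apply Rmult_lt_compat_r with (r := Rabs M + 1) in HN; [|lra].
unfold Rdiv in HN; rewrite Rmult_assoc, Rinv_l, Rmult_1_r in HN by lra.
assert (0 <= q ^ S n) by (apply pow_le; lra); pose proof (Rle_abs M); nra.
Qed.

Lemma le_of_pow_lt_1 (W A : R) (n : nat) : (forall r, 0 < r < 1 -> W * r ^ n <= A) -> W <= A.
Proof.
intros H; apply Rnot_lt_le; intros HA.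
assert (Hc : continuity_pt (fun r => W * r ^ n) 1).
{ apply continuity_pt_filterlim.
  apply (ex_derive_continuous (K := R_AbsRing) (V := R_NormedModule) (fun r => W * r ^ n)).
  auto_derive; trivial. }
destruct (Hc (W - A)) as (d & Hd & Hr); [lra|].
set (r := 1 - Rmin (d / 2) (/ 2)).
assert (H1 : 0 < Rmin (d / 2) (/ 2)) by (apply Rmin_pos; lra).
pose proof (Rmin_l (d / 2) (/ 2)); pose proof (Rmin_r (d / 2) (/ 2)).
specialize (H r ltac:(unfold r; lra)).
specialize (Hr r); simpl in Hr; unfold R_dist in Hr.
rewrite pow1, Rmult_1_r in Hr.
assert (Hlt : Rabs (W * r ^ n - W) < W - A).
{ apply Hr; split; [split; [exact I|unfold r; lra]|]; apply Rabs_def1; unfold r; lra. }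
apply Rabs_def2 in Hlt; lra.
Qed.

Section Area.

Variables (a : nat -> C) (f f' : C -> C).
Hypothesis Ha : forall r, 0 < r < 1 -> exists M, forall n, Cmod (a n) * r ^ n <= M.
Hypothesis Hsum : forall z eps, Cmod z < 1 -> 0 < eps ->
  exists N, forall n, (N <= n)%nat -> Cmod (Csum (fun k => a k * z ^ k)%C n - f z) < eps.
Hypothesis Hf : analytic_on_disc f f'.

(** The index is shifted by one, since a_0 does not enter the area. *)
Definition dirichlet_term (k : nat) : R := INR (S k) * coef_mod a (S k) ^ 2.

Lemma dirichlet_term_ge_0 (k : nat) : 0 <= dirichlet_term k.
Proof. apply Rmult_le_pos; [apply pos_INR|apply pow2_ge_0]. Qed.

Lemma deriv_Ccontinuous (z : C) : Cmod z < 1 -> Ccontinuous f' z.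
Proof.
intros Hz; pose proof (Cmod_ge_0 z) as H0; apply Ccontinuous_eps; intros eps Heps.
set (r := (Cmod z + 1) / 2); set (L := PSeries (PS_derive (PS_derive (coef_mod a))) r).
pose proof (Rabs_pos L) as HL.
assert (Hd : 0 < eps / (Rabs L + 1)) by (apply Rdiv_lt_0_compat; lra).
exists (Rmin (r - Cmod z) (eps / (Rabs L + 1))); split.
- apply Rmin_pos; [unfold r; lra|exact Hd].
- intros w Hw.
  assert (H1 : Cmod (w - z) < r - Cmod z) by (eapply Rlt_le_trans; [exact Hw|apply Rmin_l]).
  assert (H2 : Cmod (w - z) < eps / (Rabs L + 1)) by (eapply Rlt_le_trans; [exact Hw|apply Rmin_r]).
  assert (H3 : Cmod w <= r).
  { pose proof (Cmod_triangle (w - z) z) as T; replace (w - z + z)%C with w in T by ring; lra. }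
  eapply Rle_lt_trans; [apply (deriv_Lipschitz a f f' Ha Hsum Hf z w r); unfold r in *; lra|].
  fold L; apply Rmult_lt_compat_r with (r := Rabs L + 1) in H2; [|lra].
  unfold Rdiv in H2; rewrite Rmult_assoc, Rinv_l, Rmult_1_r in H2 by lra.
  pose proof (Rle_abs L); pose proof (Cmod_ge_0 (w - z)); nra.
Qed.

(** On |z| <= R0 the squared modulus of [deriv_partial m] exceeds |f'|^2 by at most 2 B [deriv_tail]
    m s, since B bounds both moduli. Parseval is thus applied to polynomials only, and m tends to
    infinity in the resulting inequality. *)
Lemma area_upto_ge (R0 : R) (n : nat) : 0 < R0 < 1 ->
  PI * Rsum (fun k => dirichlet_term k * R0 ^ (2 * k + 2)) n <= area_upto f' R0.
Proof.
intros HR; set (B := PSeries (PS_derive (coef_mod a)) R0).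
destruct (is_area_exists f' R0 B (PSeries (PS_derive (PS_derive (coef_mod a))) R0)) as [v Hv].
- exact HR.
- intros z Hz; apply (Cmod_deriv_le a f f' Ha Hsum Hf); lra.
- intros z w Hz Hw; apply (deriv_Lipschitz a f f' Ha Hsum Hf); lra.
- exact deriv_Ccontinuous.
- rewrite (area_upto_eq f' R0 v Hv).
  set (s := (R0 + 1) / 2).
  assert (H : forall m, (n <= m)%nat ->
    PI * Rsum (fun k => dirichlet_term k * R0 ^ (2 * k + 2)) n
      <= v + 2 * PI * B * R0 ^ 2 * deriv_tail a m s).
  { intros m Hm; pose proof PI_RGT_0 as HPI.
    assert (Hw : Rsum (fun k => 2 * PI * Cmod (RtoC (INR (S k)) * a (S k)) ^ 2 *
        (R0 ^ (2 * k + 2) / INR (2 * k + 2))) m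
      = PI * Rsum (fun k => dirichlet_term k * R0 ^ (2 * k + 2)) m).
    { clear - HPI; induction m as [|m IH]; [simpl; ring|].
      cbn [Rsum]; rewrite IH, Rmult_plus_distr_l; f_equal.
      rewrite Cmod_mult, Cmod_R, Rabs_pos_eq by apply pos_INR.
      unfold dirichlet_term, coef_mod.
      replace (INR (2 * m + 2)) with (2 * INR (S m))
        by (rewrite S_INR, plus_INR, mult_INR; simpl; ring).
      field; apply not_0_INR; lia. }
    (* The radial function with exponent 0 is a constant; here it subtracts the uniform error. *)
    pose proof (is_area_plus _ _ _ _ _
      (is_area_polynomial (fun k => RtoC (INR (S k)) * a (S k))%C m R0)
      (is_area_radial 0 (- (2 * B * deriv_tail a m s)) R0)) as H1.
    cbv beta in H1; rewrite Hw in H1.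
    apply (is_area_le _ _ _ _ _ (Rlt_le _ _ (proj1 HR))) with (2 := H1) in Hv.
    - replace (R0 ^ (2 * 0 + 2) / INR (2 * 0 + 2)) with (R0 ^ 2 / 2) in Hv by (simpl; field).
      assert (Hmono : Rsum (fun k => dirichlet_term k * R0 ^ (2 * k + 2)) n
        <= Rsum (fun k => dirichlet_term k * R0 ^ (2 * k + 2)) m).
      { apply Rsum_mono; [|exact Hm]; intros k.
        apply Rmult_le_pos; [apply dirichlet_term_ge_0|apply pow_le; lra]. }
      apply Rmult_le_compat_l with (r := PI) in Hmono; lra.
    - intros z Hz; simpl pow at 2; rewrite Rmult_1_l.
      pose proof (Cmod_deriv_minus_partial_le a f f' Ha Hsum Hf z s m ltac:(unfold s; lra)) as T.
      pose proof (Rabs_Cmod2_diff_le _ _ B (Cmod_deriv_le a f f' Ha Hsum Hf z R0 ltac:(lra))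
        (Cmod_deriv_partial_le a Ha z R0 m ltac:(lra))) as T1.
      assert (HB : 0 <= B).
      { eapply Rle_trans; [apply Cmod_ge_0|apply (Cmod_deriv_le a f f' Ha Hsum Hf z R0); lra]. }
      assert (T2 : 2 * B * Cmod (f' z - deriv_partial a m z) <= 2 * B * deriv_tail a m s)
        by (apply Rmult_le_compat_l; lra).
      pose proof (Rle_abs (- (Cmod (f' z) ^ 2 - Cmod (deriv_partial a m z) ^ 2))) as T3.
      rewrite Rabs_Ropp in T3; fold (deriv_partial a m z); lra. }
  assert (L := is_lim_seq_plus' _ _ _ _ (is_lim_seq_const v)
    (is_lim_seq_mult' _ _ _ _ (is_lim_seq_const (2 * PI * B * R0 ^ 2))
      (deriv_tail_lim a Ha s ltac:(unfold s; lra)))).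
  rewrite Rmult_0_r, Rplus_0_r in L.
  refine (is_lim_seq_le_loc _ _ (PI * Rsum (fun k => dirichlet_term k * R0 ^ (2 * k + 2)) n) _ _
    (is_lim_seq_const _) L).
  exists n; exact H.
Qed.

Lemma dirichlet_sum_le (A : R) (n : nat) :
  (forall R0, 0 < R0 < 1 -> area_upto f' R0 <= A) -> Rsum dirichlet_term n <= A / PI.
Proof.
intros HA; pose proof PI_RGT_0 as HPI.
(* For k < n each weight r^(2k+2) is at least r^(2n), so this single power factors out before r
   tends to 1. *)
apply (le_of_pow_lt_1 _ _ (2 * n)); intros r Hr.
apply (proj1 (Rle_div_r _ _ _ HPI)); rewrite Rmult_comm.
eapply Rle_trans; [|apply (HA r Hr)].
eapply Rle_trans; [|apply (area_upto_ge r n Hr)].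
apply Rmult_le_compat_l; [lra|]; clear HA.
assert (H : forall m, (m <= n)%nat -> Rsum dirichlet_term m * r ^ (2 * n)
  <= Rsum (fun k => dirichlet_term k * r ^ (2 * k + 2)) m).
{ intros m; induction m as [|m IH]; intros Hm; cbn [Rsum]; [lra|].
  specialize (IH ltac:(lia)).
  assert (H1 : r ^ (2 * n) <= r ^ (2 * m + 2)).
  { replace (2 * n)%nat with ((2 * m + 2) + (2 * n - (2 * m + 2)))%nat by lia.
    generalize (2 * m + 2)%nat (2 * n - (2 * m + 2))%nat; intros p q; rewrite pow_add.
    assert (r ^ q <= 1) by (rewrite <- (pow1 q); apply pow_incr; lra).
    assert (0 <= r ^ p) by (apply pow_le; lra); nra. }
  pose proof (dirichlet_term_ge_0 m); nra. }
apply H; lia.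
Qed.

End Area.

(** * The hyperbolic tangent and the logarithmic sum *)

Lemma tanh_bounds (t : R) : 0 <= t -> 0 <= tanh t < 1.
Proof.
intros Ht; unfold tanh, sinh, cosh.
assert (H : exp (- t) <= exp t).
{ destruct (Rle_lt_or_eq_dec 0 t Ht) as [H|<-]; [|rewrite Ropp_0; lra].
  apply Rlt_le, exp_increasing; lra. }
pose proof (exp_pos t); pose proof (exp_pos (- t)); split.
- apply Rdiv_le_0_compat; lra.
- apply Rlt_div_l; lra.
Qed.

Lemma is_derive_tanh_half (t : R) :
  is_derive (fun t => tanh (t / 2)) t ((1 - tanh (t / 2) ^ 2) / 2).
Proof.
unfold tanh, sinh, cosh.
pose proof (exp_pos (t / 2)); pose proof (exp_pos (- (t / 2))).
auto_derive; [repeat split; try trivial; unfold Rdiv in *; lra|].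
unfold Rdiv in *; field; lra.
Qed.

(** No logarithm is taken. With x = tanh(t/2) and x' = (1 - x^2)/2, each term has derivative x
    (x^(2k) - x^(2k+2)); these telescope to x (1 - x^(2n)) <= 1, and the mean value theorem from t =
    0 concludes. *)
Lemma Rsum_log_le (n : nat) (rho : R) : 0 <= rho ->
  Rsum (fun k => tanh (rho / 2) ^ (2 * k + 2) / INR (S k)) n <= rho.
Proof.
intros Hrho.
set (g := fun t => Rsum (fun k => tanh (t / 2) ^ (2 * k + 2) / INR (S k)) n).
set (dg := fun t => tanh (t / 2) * (1 - tanh (t / 2) ^ (2 * n))).
assert (Hg : forall t, is_derive g t (dg t)).
{ intros t; unfold g, dg; clear; induction n as [|n IH].
  - simpl; rewrite Rminus_diag, Rmult_0_r; apply (is_derive_const (V := R_NormedModule)).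
  - cbn [Rsum].
    assert (H : is_derive (fun t => tanh (t / 2) ^ (2 * n + 2) / INR (S n)) t
      (tanh (t / 2) * (tanh (t / 2) ^ (2 * n) - tanh (t / 2) ^ (2 * S n)))).
    { pose proof (is_derive_tanh_half t) as H; set (x := fun t => tanh (t / 2)) in *.
      change (is_derive (fun t => x t ^ (2 * n + 2) / INR (S n)) t
        (x t * (x t ^ (2 * n) - x t ^ (2 * S n)))).
      change (is_derive x t ((1 - x t ^ 2) / 2)) in H.
      pose proof (is_derive_pow x (2 * n + 2) t _ H) as H1.
      pose proof (is_derive_scal _ _ (/ INR (S n)) _ H1) as H2.
      assert (Hn : INR (S n) <> 0) by (apply not_0_INR; lia).
      match type of H2 with is_derive _ _ ?l => replace (x t * (x t ^ (2 * n) - x t ^ (2 * S n))) with l end.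
      - revert H2; apply is_derive_ext; intros u; apply Rmult_comm.
      - replace (INR (2 * n + 2)) with (2 * INR (S n))
          by (rewrite S_INR, plus_INR, mult_INR; simpl; ring).
        replace (pred (2 * n + 2)) with (S (2 * n)) by lia.
        replace (2 * S n)%nat with (S (S (2 * n))) by lia.
        rewrite <- !tech_pow_Rmult; field; exact Hn. }
    pose proof (is_derive_plus (V := R_NormedModule) _ _ _ _ _ IH H) as H1.
    match type of H1 with is_derive _ _ ?l =>
      replace (tanh (t / 2) * (1 - tanh (t / 2) ^ (2 * S n))) with l; [exact H1|] end.
    change plus with Rplus; match goal with |- ?u = ?v => change (@eq R u v) end; ring. }
destruct (MVT_gen g 0 rho dg) as (c & Hc & E).
- intros t _; apply Hg.
- intros t _; apply continuity_pt_filterlim.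
  apply (ex_derive_continuous (K := R_AbsRing) (V := R_NormedModule)); eexists; apply Hg.
- rewrite Rmin_left, Rmax_right in Hc by exact Hrho.
  assert (E0 : g 0 = 0).
  { unfold g; replace (tanh (0 / 2)) with 0.
    - clear; induction n as [|n IH]; [reflexivity|]; cbn [Rsum]; rewrite IH, pow_add.
      simpl (0 ^ 2); unfold Rdiv; ring.
    - unfold tanh; replace (0 / 2) with 0 by field; rewrite sinh_0; unfold Rdiv; ring. }
  assert (H1 : 0 <= tanh (c / 2) < 1) by (apply tanh_bounds; lra).
  assert (H2 : 0 <= tanh (c / 2) ^ (2 * n)) by (apply pow_le; lra).
  assert (H3 : dg c <= 1) by (unfold dg; nra).
  change (g rho <= rho); nra.
Qed.

(** * The length of a radius *)

Lemma bounded_Rsum_tail (u : nat -> R) (M eps : R) : (forall k, 0 <= u k) ->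
  (forall n, Rsum u n <= M) -> 0 < eps ->
  exists N, forall n, Rsum u n - Rsum u N <= eps.
Proof.
intros Hu HM Heps.
destruct (completeness (fun y => exists n, y = Rsum u n)) as [l [Hl1 Hl2]].
- exists M; intros y [n ->]; apply HM.
- now exists (Rsum u 0), 0%nat.
- apply NNPP; intros Hn; apply (Rlt_irrefl l); apply Rle_lt_trans with (l - eps); [|lra].
  apply Hl2; intros y [N ->]; apply Rnot_lt_le; intros HN; apply Hn; exists N; intros n.
  assert (Rsum u n <= l) by (apply Hl1; now exists n); lra.
Qed.

(* Weighted AM-GM: [p x <= m p^2 / (2 lambda) + lambda x^2 / (2 m)]. *)
Lemma Rsum_amgm (p : nat -> R) (x lambda : R) (n m : nat) : 0 < lambda -> (n <= m)%nat ->
  Rsum (fun k => p k * x ^ S k) m - Rsum (fun k => p k * x ^ S k) n <=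
  (Rsum (fun k => INR (S k) * p k ^ 2) m - Rsum (fun k => INR (S k) * p k ^ 2) n) / (2 * lambda) +
  lambda / 2 * (Rsum (fun k => x ^ (2 * k + 2) / INR (S k)) m -
                Rsum (fun k => x ^ (2 * k + 2) / INR (S k)) n).
Proof.
intros Hl Hnm; induction Hnm as [|m _ IH].
- rewrite !Rminus_diag; unfold Rdiv; lra.
- cbn [Rsum]; replace (2 * m + 2)%nat with (S m * 2)%nat by lia; rewrite pow_mult.
  set (q := INR (S m)); assert (Hq : 0 < q) by (apply lt_0_INR; lia).
  assert (H : p m * x ^ S m <= q * p m ^ 2 / (2 * lambda) + lambda / 2 * ((x ^ S m) ^ 2 / q)).
  { assert (E : q * p m ^ 2 / (2 * lambda) + lambda / 2 * ((x ^ S m) ^ 2 / q) - p m * x ^ S m =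
      (q * p m - lambda * x ^ S m) ^ 2 / (2 * lambda * q)) by (field; lra).
    assert (0 <= (q * p m - lambda * x ^ S m) ^ 2 / (2 * lambda * q)).
    { apply Rdiv_le_0_compat; [apply pow2_ge_0|]; assert (0 < lambda * q) by nra; lra. }
    lra. }
  unfold Rdiv in *; lra.
Qed.

(** The hyperbolic weight (1 - x^2)/2 is the derivative of x = tanh(t/2), so the dominating
    integrand [g] is the derivative of [PSeries b] composed with x and integrates in closed form. *)
Lemma L_E_le_PSeries (f' : C -> C) (b : nat -> R) (theta rho : R) : 0 < rho ->
  (forall x, Rabs x < 1 -> Rbar_lt (Rabs x) (CV_radius b)) ->
  (forall z, Cmod z < 1 -> Cmod (f' z) <= PSeries (PS_derive b) (Cmod z)) ->
  Rabs (L_E f' theta rho) <= PSeries b (tanh (rho / 2)) - b O.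
Proof.
intros Hrho Hb Hf'.
set (x := fun t => tanh (t / 2)).
assert (Hx : forall t, 0 <= t -> 0 <= x t < 1) by (intros t Ht; apply tanh_bounds; lra).
assert (Hxr : forall t, 0 <= t -> Rbar_lt (Rabs (x t)) (CV_radius b)).
{ intros t Ht; apply Hb; rewrite Rabs_pos_eq; apply Hx in Ht; lra. }
set (g := fun t => (1 - x t ^ 2) / 2 * PSeries (PS_derive b) (x t)).
assert (Hg : is_RInt g 0 rho (minus (PSeries b (x rho)) (PSeries b (x 0)))).
{ apply (is_RInt_derive (V := R_CompleteNormedModule) (fun t => PSeries b (x t)));
    rewrite Rmin_left, Rmax_right by lra; intros t Ht.
  - apply (is_derive_comp (PSeries b) x); [apply is_derive_PSeries, Hxr; lra|apply is_derive_tanh_half].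
  - assert (Hxc : continuous x t).
    { apply (ex_derive_continuous (K := R_AbsRing) (V := R_NormedModule)); eexists; apply is_derive_tanh_half. }
    apply (continuous_mult (K := R_AbsRing)).
    + apply (continuous_comp x (fun y => (1 - y ^ 2) / 2)); [exact Hxc|].
      apply (ex_derive_continuous (K := R_AbsRing) (V := R_NormedModule)); auto_derive; trivial.
    + apply (continuous_comp x (PSeries (PS_derive b))); [exact Hxc|].
      apply continuity_pt_filterlim, PSeries_continuity.
      rewrite CV_radius_derive; apply Hxr; lra. }
assert (E : minus (PSeries b (x rho)) (PSeries b (x 0)) = PSeries b (tanh (rho / 2)) - b O).
{ assert (Hx0 : x 0 = 0).
  { unfold x, tanh; replace (0 / 2) with 0 by field; rewrite sinh_0; unfold Rdiv; ring. }
  rewrite Hx0, PSeries_0; reflexivity. }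
rewrite E in Hg.
assert (Hnorm : forall t, 0 <= t <= rho -> Rabs (normHE f' (gammaH theta t)) <= g t).
{ intros t Ht; assert (Hxt := Hx t ltac:(lra)).
  assert (Hm : Cmod (gammaH theta t) = x t) by (unfold gammaH; rewrite Cmod_Cpolar; apply Rabs_pos_eq, Hxt).
  unfold normHE, lambda_H; change Defs.Cmod with Cmod; rewrite Hm.
  assert (H1 : 0 < (1 - x t ^ 2) / 2) by nra.
  replace (Cmod (f' (gammaH theta t)) / (2 / (1 - x t ^ 2)))
    with ((1 - x t ^ 2) / 2 * Cmod (f' (gammaH theta t))) by (field; nra).
  rewrite Rabs_pos_eq by (apply Rmult_le_pos; [lra|apply Cmod_ge_0]).
  apply Rmult_le_compat_l; [lra|].
  rewrite <- Hm; apply Hf'; rewrite Hm; apply Hxt. }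
unfold L_E, Defs.RInt; destruct (excluded_middle_informative _) as [Hi|_].
- set (pr := epsilon Hi (fun _ => True)).
  exact (norm_RInt_le (V := R_NormedModule) _ g 0 rho _ _ (Rlt_le _ _ Hrho) Hnorm
    (ex_RInt_Reals_aux_1 _ _ _ pr) Hg).
(* Default branch: [L_E] is 0, and the bound is the integral of the nonnegative [g]. *)
- rewrite Rabs_R0.
  refine (is_RInt_le (fun _ => 0) g 0 rho 0 _ (Rlt_le _ _ Hrho) _ Hg _).
  + replace 0 with (scal (rho - 0) 0) at 2 by (unfold scal; simpl; unfold mult; simpl; ring).
    apply (is_RInt_const (V := R_NormedModule)).
  + intros t Ht; eapply Rle_trans; [apply Rabs_pos|apply Hnorm; lra].
Qed.

Theorem theorem3p1 (f f' : Cx -> Cx) :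
  analytic_on_disc f f' -> finite_area f' ->
  forall theta : R,
  forall eps : R, 0 < eps -> exists M : R, forall rho0 : R, M < rho0 ->
    Rabs (L_E f' theta rho0) <= eps * sqrt rho0.
Proof.
intros Hf [A HA] theta eps Heps.
pose proof (taylor_coef_bound f f' Hf) as Hb.
pose proof (taylor_converges f f' Hf) as Hs.
set (a := taylor_coef f) in *.
(* With s = sqrt rho, the first N terms will cost e s. With weight lambda = e / s, a Dirichlet tail
   below e^2 costs e^2 / (2 lambda) = e s / 2, and the logarithmic sum costs lambda rho / 2 = e s /
   2. The total is 2 e s. *)
set (e := eps / 2); assert (He : 0 < e) by (unfold e; lra).
destruct (bounded_Rsum_tail (dirichlet_term a) (A / PI) (e ^ 2)) as [N HN].
- apply dirichlet_term_ge_0.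
- intros n; exact (dirichlet_sum_le a f f' Hb Hs Hf A n HA).
- now apply pow_lt.
- set (K := Rsum (fun k => coef_mod a (S k)) N).
  assert (HK : 0 <= K) by exact (Rsum_mono _ 0 N (fun k => Cmod_ge_0 _) (Nat.le_0_l N)).
  (* Beyond this threshold sqrt rho exceeds K / e, so the fixed block of N terms is at most e sqrt
     rho. *)
  exists ((K / e) ^ 2); intros rho Hrho.
  assert (Hrho0 : 0 < rho) by (pose proof (pow2_ge_0 (K / e)); lra).
  set (s := sqrt rho); assert (Hs0 : 0 < s) by now apply sqrt_lt_R0.
  assert (Hss : s * s = rho) by (apply sqrt_sqrt; lra).
  assert (HKs : K <= e * s).
  { apply Rle_trans with (e * (K / e)); [apply Req_le; field; lra|].
    apply Rmult_le_compat_l; [lra|]; apply Rlt_le, Rsqr_incrst_0; unfold Rsqr;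
      [lra|apply Rdiv_le_0_compat; lra|lra]. }
  set (x := tanh (rho / 2)); assert (Hx : 0 <= x < 1) by (apply tanh_bounds; lra).
  eapply Rle_trans.
  { apply (L_E_le_PSeries f' (coef_mod a)); [exact Hrho0|apply coef_mod_radius, Hb|].
    intros z Hz; apply (Cmod_deriv_le a f f' Hb Hs Hf); lra. }
  fold x; apply Rle_minus_l.
  assert (L : is_lim_seq (fun n => Rsum (fun k => coef_mod a k * x ^ k) (S n)) (PSeries (coef_mod a) x)).
  { apply is_lim_seq_incr_1 with (u := Rsum (fun k => coef_mod a k * x ^ k)).
    apply is_lim_seq_Rsum, is_series_PSeries, coef_mod_radius; [exact Hb|rewrite Rabs_pos_eq; lra]. }
  refine (is_lim_seq_le_loc _ _ _ (eps * s + coef_mod a 0) _ L (is_lim_seq_const _)).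
  (* Splitting off the term of index 0 cancels the [coef_mod a 0] that the length bound
     subtracts. *)
  exists N; intros n Hn; rewrite Rsum_shift; simpl pow at 1; rewrite Rmult_1_r, Rplus_comm.
  apply Rplus_le_compat_r.
  assert (Hl : 0 < e / s) by (apply Rdiv_lt_0_compat; lra).
  pose proof (Rsum_amgm (fun k => coef_mod a (S k)) x (e / s) N n Hl Hn) as H1.
  cbv beta in H1; change (fun k => INR (S k) * coef_mod a (S k) ^ 2) with (dirichlet_term a) in H1.
  assert (H2 : Rsum (fun k => coef_mod a (S k) * x ^ S k) N <= K).
  { apply Rsum_le; intros k; rewrite <- (Rmult_1_r (coef_mod a (S k))) at 2.
    apply Rmult_le_compat_l; [apply Cmod_ge_0|]; rewrite <- (pow1 (S k)); apply pow_incr; lra. }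
  assert (H3 : (Rsum (dirichlet_term a) n - Rsum (dirichlet_term a) N) / (2 * (e / s)) <= e * s / 2).
  { replace (e * s / 2) with (e ^ 2 / (2 * (e / s))) by (field; lra).
    apply Rmult_le_compat_r; [apply Rlt_le, Rinv_0_lt_compat; lra|apply HN]. }
  pose proof (Rsum_log_le n rho ltac:(lra)) as H4; fold x in H4.
  assert (H5 : 0 <= Rsum (fun k => x ^ (2 * k + 2) / INR (S k)) N).
  { apply (Rsum_mono _ 0 N); [|lia]; intros k.
    apply Rdiv_le_0_compat; [apply pow_le; lra|apply lt_0_INR; lia]. }
  assert (H6 : e / s / 2 * (Rsum (fun k => x ^ (2 * k + 2) / INR (S k)) n -
    Rsum (fun k => x ^ (2 * k + 2) / INR (S k)) N) <= e * s / 2).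
  { replace (e * s / 2) with (e / s / 2 * rho) by (rewrite <- Hss; field; lra).
    apply Rmult_le_compat_l; lra. }
  replace (eps * s) with (e * s + (e * s / 2 + e * s / 2)) by (unfold e; field).
  lra.
Qed.
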